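(* Assume that $A(S)\subseteq \mathrm{ri}(\mathrm{dom}\, g)$, that $\inf_{x\in S}F(x)>-\infty$, that $K(S)\subseteq \mathrm{ri}(\mathrm{dom}\, f)$, and that $r>0$ is such that $\mathcal K_r:=\{z\in\mathbb R^s: \mathrm{dist}(z,A(S))\le r\}\subseteq \mathrm{int}(\mathrm{dom}\, g)$; let $\ell_{g,\mathcal K_r}>0$ be the Lipschitz constant of $g$ on $\mathcal K_r$. For $0<\gamma\le \frac{2r}{\ell_{g,\mathcal K_r}}$ and $\|z^0\|\le \ell_{g,\mathcal K_r}$, let $(x^k,y^k,z^k)_{k\ge0}$ be the sequence generated by the Adaptive DPFS algorithm (described in the context), where the scalar sequences $(\alpha_k)_{k\ge0}$, $(\beta_k)_{k\ge0}$, $(\delta_k)_{k\ge0}$ and $(\rho_k)_{k\ge0}$ are chosen such that the conditions (P1)-(P5) listed in the context are satisfied. Let $0<\varepsilon\le r$ (with $\varepsilon$ the tolerance used in the algorithm) and let $\ell_{g,\mathcal K_\varepsilon}>0$ be the Lipschitz constant of $g$ on the compact set $\mathcal K_\varepsilon=\{z\in\mathbb R^s:\mathrm{dist}(z,A(S))\le\varepsilon\}\subseteq \mathrm{int}(\mathrm{dom}\, g)$. Then every accumulation point of the sequence $(x^k,y^k,z^k)_{k\ge 0}$ is a $(2\ell_{g,\mathcal K_\varepsilon}\varepsilon)$-approximate KKT point of the problem $\min_{x\in S}F(x)$.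
   Context: Setting. $S\subseteq\mathbb R^n$ is nonempty, convex and compact; $f:\mathbb R^p\to\mathbb R\cup\{\pm\infty\}$ and $g:\mathbb R^s\to\mathbb R\cup\{\pm\infty\}$ are proper, convex and lower semicontinuous; $A:\mathbb R^n\to\mathbb R^s$ and $K:\mathbb R^n\to\mathbb R^p$ are linear with adjoints $A^*,K^*$; $\varphi:\mathbb R^n\to\mathbb R$ is differentiable with $\ell_{\nabla\varphi}$-Lipschitz continuous gradient. $F(x):=g(Ax)+\varphi(x)-f(Kx)$. $\sigma_A:=\|A\|^2$ is the largest eigenvalue of $A^*A$. $\mathrm{dom}\,h=\{x:h(x)<+\infty\}$; $\mathrm{ri}$ and $\mathrm{int}$ denote relative interior and interior; $\mathrm{dist}(z,C)=\inf_{c\in C}\|z-c\|$; $h^*$ is the Fenchel conjugate of $h$; $\mathrm{Proj}_S$ is the projection onto $S$; $\mathrm{Prox}_{h,t}(w):=\arg\min_x\{h(x)+\frac1{2t}\|x-w\|^2\}$; $N_S$ is the normal cone of $S$; $\partial$ is the convex subdifferential. For $\epsilon\ge0$ and convex $h$ with $h(\bar x)\in\mathbb R$, $\partial_\epsilon h(\bar x):=\{v: h(x)\ge h(\bar x)+\langle v,x-\bar x\rangle-\epsilon\ \forall x\}$ (empty if $h(\bar x)\notin\mathbb R$). A triple $(\bar x,\bar y,\bar z)\in\mathbb R^n\times\mathbb R^p\times\mathbb R^s$ is an $\epsilon$-approximate KKT point of $\min_{x\in S}F(x)$ if $A\bar x\in\partial_\epsilon g^*(\bar z)$, $K\bar x\in\partial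 f^*(\bar y)$ and $K^*\bar y\in A^*\bar z+\nabla\varphi(\bar x)+N_S(\bar x)$. Parameter conditions (with $\gamma>0$, $\frac\gamma2>\alpha>0$, $\mu>0$): (P1) $\lim_{k\to+\infty}\alpha_k=\alpha$ and $\alpha+\gamma\ge\alpha_0\ge\alpha_k\ge\alpha_{k+1}>\alpha$ for all $k\ge0$; (P2) $\frac{\alpha_k-\alpha_{k+1}}{(\alpha_{k+1}-\alpha)(\alpha_k-\alpha)}\le\frac1\gamma$ and $(\alpha_k-\alpha)(\alpha_{k+2}-\alpha)\ge(\alpha_{k+1}-\alpha)^2$ for all $k\ge0$; (P3) $+\infty>\overline\beta\ge\beta_k\ge\underline\beta>0$ for all $k\ge0$; (P4) $\delta_k:=\frac{\alpha}{\alpha_k}$ for all $k\ge0$; (P5) $\rho_k:=\frac{\ell_{\nabla\varphi}}2+\frac{3\sigma_A\gamma}{2(\alpha_k-\alpha)^2}+\mu$ for all $k\ge0$. Adaptive DPFS. Given $\ell_{\nabla\varphi}>0$, $\sigma_A>0$, choose $\beta_0>0$, $\rho_0>0$, $0<\alpha<\frac\gamma2$, $\alpha_0=\alpha+\gamma$, $\delta_0=\frac\alpha{\alpha_0}$, $\mu>0$, $\varepsilon>0$ and a starting point $(x^0,y^0,z^0)$. For $k=0,1,2,\dots$: $x^{k+1}:=\mathrm{Proj}_S\big(x^k+\frac1{\rho_k}(-\nabla\varphi(x^k)+K^*y^k-A^*z^k)\big)$, $y^{k+1}:=\mathrm{Prox}_{f^*,1/\beta_k}(y^k+\frac1{\beta_k}Kx^{k+1})$,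 $z^{k+1}:=\mathrm{Prox}_{g^*,1/\alpha_k}(\delta_kz^k+\frac1{\alpha_k}Ax^{k+1})$; if $(\alpha_k-\alpha)\|z^{k+1}\|>\varepsilon$, then update $\alpha_{k+1}$ according to (P1) and (P2), and set $\rho_{k+1}:=\frac{\ell_{\nabla\varphi}}2+\frac{3\gamma\sigma_A}{2(\alpha_{k+1}-\alpha)^2}+\mu$, $\delta_{k+1}:=\frac\alpha{\alpha_{k+1}}$; otherwise set $\alpha_{k+1}:=\alpha_k$, $\rho_{k+1}:=\rho_k$, $\delta_{k+1}:=\delta_k$. In either case update $\beta_{k+1}$ dynamically to satisfy (P3). *)

(* Defs.v *)
From HB Require Import structures.
From mathcomp Require Import all_boot all_order all_algebra.
From mathcomp Require Import all_classical all_reals all_analysis.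
Import Order.TTheory GRing.Theory Num.Theory.
Import numFieldNormedType.Exports.

Set Implicit Arguments.
Unset Strict Implicit.
Unset Printing Implicit Defensive.

Local Open Scope classical_set_scope.
Local Open Scope ring_scope.

(* R^n is 'cV[R]_n, linear maps are matrices in the standard bases, and adjoints
   are transposes.  The library norm `|x| on matrices is the sup norm: it is
   used only through the topology it induces (compactness, interior, cluster
   points, lower semicontinuity, differentiability), which is the usual one.
   Every metric quantity below uses the Euclidean norm enorm. *)

Section Euclidean.
Context {R : realType}.

Definition dotp n (u v : 'cV[R]_n) : R := \sum_(i < n) u i 0 * v i 0.

Definition enorm n (u : 'cV[R]_n) : R := Num.sqrt (dotp u u).

Definition opnorm m n (A : 'M[R]_(m, n)) : R :=
  sup [set enorm (A *m x) | x in [set x : 'cV[R]_n | enorm x <= 1]].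

Definition mximage m n (A : 'M[R]_(m, n)) (S : set 'cV[R]_n) : set 'cV[R]_m :=
  [set A *m x | x in S].

Definition setdist n (z : 'cV[R]_n) (C : set 'cV[R]_n) : R :=
  inf [set enorm (z - c) | c in C].

Definition tube n (C : set 'cV[R]_n) (r : R) : set 'cV[R]_n :=
  [set z | setdist z C <= r].

Definition affine_hull n (C : set 'cV[R]_n) : set 'cV[R]_n :=
  [set x | exists (m : nat) (c : 'I_m -> R) (v : 'I_m -> 'cV[R]_n),
    [/\ forall i, C (v i), \sum_(i < m) c i = 1
      & x = \sum_(i < m) c i *: v i]].

Definition relint n (C : set 'cV[R]_n) : set 'cV[R]_n :=
  [set x | C x /\ exists2 e : R, 0 < e &
    forall y, affine_hull C y -> enorm (y - x) < e -> C y].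

Definition Proj n (S : set 'cV[R]_n) (w : 'cV[R]_n) : set 'cV[R]_n :=
  [set u | S u /\ forall v, S v -> enorm (u - w) <= enorm (v - w)].

Definition normal_cone n (S : set 'cV[R]_n) (x : 'cV[R]_n) : set 'cV[R]_n :=
  [set v | S x /\ forall u, S u -> dotp v (u - x) <= 0].

Definition gradient n (phi : 'cV[R]_n -> R) (x : 'cV[R]_n) : 'cV[R]_n :=
  \col_(i < n) ('d phi x (delta_mx i 0)).

End Euclidean.

Section ExtendedValued.
Context {R : realType}.
Local Open Scope ereal_scope.

Definition edom n (h : 'cV[R]_n -> \bar R) : set 'cV[R]_n := [set x | h x < +oo].

Definition proper_efun n (h : 'cV[R]_n -> \bar R) : Prop :=
  (forall x, -oo < h x) /\ exists x, h x < +oo.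

(* Only used for proper functions, so -oo + +oo never arises. *)
Definition convex_efun n (h : 'cV[R]_n -> \bar R) : Prop :=
  forall (x y : 'cV[R]_n) (t : R), (0 < t)%R -> (t < 1)%R ->
    h (t *: x + (1 - t) *: y)%R <= t%:E * h x + (1 - t)%:E * h y.

Definition conjugate n (h : 'cV[R]_n -> \bar R) (v : 'cV[R]_n) : \bar R :=
  ereal_sup [set (dotp v x)%:E - h x | x in setT].

Definition eps_subdiff n (eps : R) (h : 'cV[R]_n -> \bar R) (x : 'cV[R]_n) :
    set 'cV[R]_n :=
  [set v | h x \is a fin_num /\
    forall u, h x + (dotp v (u - x)%R)%:E - eps%:E <= h u].

Definition subdiff n (h : 'cV[R]_n -> \bar R) (x : 'cV[R]_n) : set 'cV[R]_n :=
  eps_subdiff 0%R h x.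

Definition argmin n (h : 'cV[R]_n -> \bar R) : set 'cV[R]_n :=
  [set x | forall u, h x <= h u].

Definition Prox n (h : 'cV[R]_n -> \bar R) (t : R) (w : 'cV[R]_n) :
    set 'cV[R]_n :=
  argmin (fun x => h x + (1 / (2 * t) * enorm (x - w) ^+ 2)%:E).

Definition is_lipschitz_on n (h : 'cV[R]_n -> \bar R) (C : set 'cV[R]_n)
    (l : R) : Prop :=
  forall u v, C u -> C v -> `|h u - h v| <= (l * enorm (u - v))%:E.

Definition objective n p s (f : 'cV[R]_p -> \bar R) (g : 'cV[R]_s -> \bar R)
    (phi : 'cV[R]_n -> R) (A : 'M[R]_(s, n)) (K : 'M[R]_(p, n))
    (x : 'cV[R]_n) : \bar R :=
  g (A *m x)%R + (phi x)%:E - f (K *m x)%R.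

Definition approx_KKT n p s (S : set 'cV[R]_n) (f : 'cV[R]_p -> \bar R)
    (g : 'cV[R]_s -> \bar R) (phi : 'cV[R]_n -> R) (A : 'M[R]_(s, n))
    (K : 'M[R]_(p, n)) (eps : R)
    (x : 'cV[R]_n) (y : 'cV[R]_p) (z : 'cV[R]_s) : Prop :=
  [/\ eps_subdiff eps (conjugate g) z (A *m x)%R,
      subdiff (conjugate f) y (K *m x)%R
    & exists2 v, normal_cone S x v &
        (K^T *m y = A^T *m z + gradient phi x + v)%R].

End ExtendedValued.

Section Algorithm.
Context {R : realType}.

(* In the conditions below, al is the limit value alpha of the sequence. *)

Definition P1 (al gamma : R) (alpha : nat -> R) : Prop :=
  alpha @ \oo --> al /\
  forall k, [/\ alpha 0%N <= al + gamma, alpha k <= alpha 0%N,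
                alpha k.+1 <= alpha k & al < alpha k.+1].

Definition P2 (al gamma : R) (alpha : nat -> R) : Prop :=
  forall k,
    (alpha k - alpha k.+1) / ((alpha k.+1 - al) * (alpha k - al)) <= 1 / gamma /\
    (alpha k.+1 - al) ^+ 2 <= (alpha k - al) * (alpha k.+2 - al).

Definition P3 (beta : nat -> R) : Prop :=
  exists blo bup : R, 0 < blo /\ forall k, blo <= beta k /\ beta k <= bup.

Definition P4 (al : R) (alpha delta : nat -> R) : Prop :=
  forall k, delta k = al / alpha k.

Definition P5 (lphi sigma al gamma mu : R) (alpha rho : nat -> R) : Prop :=
  forall k, rho k =
    lphi / 2 + 3 * sigma * gamma / (2 * (alpha k - al) ^+ 2) + mu.

(* The parameter alpha_k is kept unless the test eps < (alpha_k - al) |z^{k+1}|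
   succeeds.  Requiring P1 of (alpha_k) itself would be contradictory: the
   z^k are bounded, so alpha_k -> al makes the test fail from some point on,
   which freezes alpha_k at a value > al.  Hence P1 and P2 are imposed on
   the sequence a of successive values used by the updates: j k counts the
   updates made before step k, and an update moves on to the next value. *)
Definition adaptive_alpha s (al gamma eps : R) (z : nat -> 'cV[R]_s)
    (alpha : nat -> R) : Prop :=
  exists (a : nat -> R) (j : nat -> nat),
    [/\ P1 al gamma a, P2 al gamma a, a 0%N = al + gamma, j 0%N = 0%N
      & forall k, alpha k = a (j k) /\
          j k.+1 = if eps < (alpha k - al) * enorm (z k.+1)
                   then (j k).+1 else j k].

(* Proj and Prox are sets of minimizers; they are singletons in the situations
   where they are used. *)
Record adaptive_DPFS n p s (S : set 'cV[R]_n) (f : 'cV[R]_p -> \bar R)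
    (g : 'cV[R]_s -> \bar R) (phi : 'cV[R]_n -> R) (A : 'M[R]_(s, n))
    (K : 'M[R]_(p, n)) (lphi al gamma mu eps : R)
    (alpha beta delta rho : nat -> R)
    (x : nat -> 'cV[R]_n) (y : nat -> 'cV[R]_p) (z : nat -> 'cV[R]_s) : Prop :=
  AdaptiveDPFS {
    dpfs_x : forall k,
      Proj S (x k + (1 / rho k) *:
                (- gradient phi (x k) + K^T *m y k - A^T *m z k)) (x k.+1) ;
    dpfs_y : forall k,
      Prox (conjugate f) (1 / beta k)
           (y k + (1 / beta k) *: (K *m x k.+1)) (y k.+1) ;
    dpfs_z : forall k,
      Prox (conjugate g) (1 / alpha k)
           (delta k *: z k + (1 / alpha k) *: (A *m x k.+1)) (z k.+1) ;
    dpfs_alpha : adaptive_alpha al gamma eps z alpha ;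
    dpfs_beta : P3 beta ;
    dpfs_delta : P4 al alpha delta ;
    dpfs_rho : P5 lphi (opnorm A ^+ 2) al gamma mu alpha rho
  }.

End Algorithm.

(* Main.v *)
(* Write c = alpha_k - al.  The dual iterates satisfy
     A x^{k+1} - c z^{k+1} + al (z^k - z^{k+1}) \in \partial g^*(z^{k+1}).
   An induction based on the Lipschitz constant of g on K_r keeps |z^k| <= l_{g,K_r},
   so, as a_m -> al, the test of the algorithm succeeds only finitely often: alpha_k
   is eventually constant and c |z^k| <= eps from then on.  For constant alpha_k,
     phi(x^k) + f^*(y^k) - <K x^k, y^k> + <A x^k, z^k> - g^*(z^k) - c/2 |z^k|^2
       + (3 gamma al / (2 c)) |z^k - z^{k-1}|^2
   is bounded below and decreases by at least a fixed multiple of the squared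
   increments of x, y and z, which therefore vanish.  Passing to the limit, an
   accumulation point satisfies w := A x - c z \in \partial g^*(z) with
   |w - A x| <= eps; Fenchel's equality at w and the Lipschitz continuity of g on
   K_eps turn this into A x \in \partial_e g^*(z) with e = l_{g,K_eps} eps. *)

Require Import Defs.
From HB Require Import structures.
From mathcomp Require Import all_boot all_order all_algebra.
From mathcomp Require Import all_classical all_reals all_analysis.
From mathcomp Require Import ring lra.
Import Order.TTheory GRing.Theory Num.Theory.
Import numFieldNormedType.Exports.

Local Open Scope classical_set_scope.
Local Open Scope ring_scope.

(** * Euclidean norm *)

Section EuclideanSpace.
Set Implicit Arguments.
Unset Strict Implicit.
Context {R : realType}.

Lemma dotpC n (u v : 'cV[R]_n) : dotp u v = dotp v u.
Proof. by apply: eq_bigr => i _; rewrite mulrC. Qed.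

Lemma dotpDl n (u v w : 'cV[R]_n) : dotp (u + v) w = dotp u w + dotp v w.
Proof.
by rewrite /dotp -big_split; apply: eq_bigr => i _; rewrite mxE mulrDl.
Qed.

Lemma dotpZl n a (u v : 'cV[R]_n) : dotp (a *: u) v = a * dotp u v.
Proof. by rewrite /dotp mulr_sumr; apply: eq_bigr => i _; rewrite mxE mulrA. Qed.

Lemma dotpNl n (u v : 'cV[R]_n) : dotp (- u) v = - dotp u v.
Proof. by rewrite -scaleN1r dotpZl mulN1r. Qed.

Lemma dotpDr n (u v w : 'cV[R]_n) : dotp w (u + v) = dotp w u + dotp w v.
Proof. by rewrite dotpC dotpDl !(dotpC w). Qed.

Lemma dotpZr n a (u v : 'cV[R]_n) : dotp v (a *: u) = a * dotp v u.
Proof. by rewrite dotpC dotpZl (dotpC v). Qed.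

Lemma dotpNr n (u v : 'cV[R]_n) : dotp v (- u) = - dotp v u.
Proof. by rewrite dotpC dotpNl (dotpC v). Qed.

Lemma dotp0r n (u : 'cV[R]_n) : dotp u 0 = 0.
Proof. by rewrite -(scale0r 0) dotpZr mul0r. Qed.

Definition dotpE := (dotpDl, dotpDr, dotpNl, dotpNr, dotpZl, dotpZr).

Lemma dotp_mulmx m n (A : 'M[R]_(m, n)) u v :
  dotp (A *m u) v = dotp u (A^T *m v).
Proof.
rewrite /dotp.
under eq_bigr do rewrite mxE mulr_suml.
under [RHS]eq_bigr do rewrite mxE mulr_sumr.
rewrite exchange_big /=; apply: eq_bigr => i _; apply: eq_bigr => j _.
by rewrite mxE mulrCA mulrA.
Qed.

Lemma dotp_ge0 n (u : 'cV[R]_n) : 0 <= dotp u u.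
Proof. by apply: sumr_ge0 => i _; rewrite -expr2 sqr_ge0. Qed.

Lemma enorm_ge0 n (u : 'cV[R]_n) : 0 <= enorm u.
Proof. exact: sqrtr_ge0. Qed.

Lemma enorm_sqr n (u : 'cV[R]_n) : enorm u ^+ 2 = dotp u u.
Proof. by rewrite sqr_sqrtr ?dotp_ge0. Qed.

Lemma enormZ n a (u : 'cV[R]_n) : enorm (a *: u) = `|a| * enorm u.
Proof. by rewrite /enorm dotpZl dotpZr mulrA -expr2 sqrtrM ?sqr_ge0// sqrtr_sqr. Qed.

Lemma enorm0 n : enorm (0 : 'cV[R]_n) = 0.
Proof. by rewrite /enorm dotp0r sqrtr0. Qed.

Lemma enorm_leP n (u : 'cV[R]_n) a : 0 <= a -> (enorm u <= a) = (dotp u u <= a ^+ 2).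
Proof. by move=> a0; rewrite -enorm_sqr ler_sqr ?nnegrE ?enorm_ge0. Qed.

Lemma normr_le_enorm n (u : 'cV[R]_n) : `|u| <= enorm u.
Proof.
rewrite [leLHS]/Num.Def.normr/= mx_normrE; apply/bigmax_leP; split; first exact: enorm_ge0.
move=> [i j] _ /=; rewrite (ord1 j) -sqrtr_sqr ler_sqrt ?dotp_ge0//.
rewrite /dotp (bigD1 i)//= expr2 lerDl sumr_ge0// => k _.
by rewrite -expr2 sqr_ge0.
Qed.

Lemma enorm_eq0 n (u : 'cV[R]_n) : enorm u = 0 -> u = 0.
Proof.
by move=> u0; apply/eqP; rewrite -normr_le0 -u0 normr_le_enorm.
Qed.

Lemma dotp_le_enorm n (u v : 'cV[R]_n) : dotp u v <= enorm u * enorm v.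
Proof.
have [/enorm_eq0 ->|v0] := eqVneq (enorm v) 0.
  by rewrite dotp0r mulr_ge0 ?enorm_ge0.
have [/enorm_eq0 ->|u0] := eqVneq (enorm u) 0.
  by rewrite dotpC dotp0r mulr_ge0 ?enorm_ge0.
have {}u0 : 0 < enorm u by rewrite lt0r u0 enorm_ge0.
have {}v0 : 0 < enorm v by rewrite lt0r v0 enorm_ge0.
(* This expands to 2 |u| |v| (|u| |v| - <u, v>) >= 0. *)
have := dotp_ge0 (enorm v *: u - enorm u *: v).
rewrite !dotpE -!enorm_sqr (dotpC v u) => H.
have : 0 <= enorm u * enorm v * (enorm u * enorm v - dotp u v) by nra.
by rewrite pmulr_rge0 ?mulr_gt0// subr_ge0.
Qed.

Lemma enormN n (u : 'cV[R]_n) : enorm (- u) = enorm u.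
Proof. by rewrite /enorm dotpNl dotpNr opprK. Qed.

Lemma enormB n (u v : 'cV[R]_n) : enorm (u - v) = enorm (v - u).
Proof. by rewrite -enormN opprB. Qed.

Lemma normr_dotp n (u v : 'cV[R]_n) : `|dotp u v| <= enorm u * enorm v.
Proof.
by rewrite ler_norml dotp_le_enorm lerNl -dotpNl -(enormN u) dotp_le_enorm.
Qed.

Lemma enormD n (u v : 'cV[R]_n) : enorm (u + v) <= enorm u + enorm v.
Proof.
rewrite enorm_leP ?addr_ge0 ?enorm_ge0// !dotpE -!enorm_sqr (dotpC v u).
by have := dotp_le_enorm u v; lra.
Qed.

(** With [normr_le_enorm], this makes the Euclidean norm equivalent to the sup norm that carries the
    topology. *)
Lemma enorm_le_normr n (u : 'cV[R]_n) : enorm u <= Num.sqrt n%:R * `|u|.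
Proof.
rewrite enorm_leP ?mulr_ge0 ?sqrtr_ge0// exprMn sqr_sqrtr ?ler0n//.
rewrite /dotp (le_trans (y := \sum_(i < n) `|u| ^+ 2))//; last first.
  by rewrite sumr_const card_ord mulr_natl.
apply: ler_sum => i _; rewrite -expr2 -[leLHS]ger0_norm ?sqr_ge0// normrX.
rewrite ler_sqr ?nnegrE// [leRHS]/Num.Def.normr/= mx_normrE.
by apply/bigmax_geP; right; exists (i, 0).
Qed.

Lemma enorm_continuous n : continuous (@enorm R n).
Proof.
move=> u; apply/(@cvgrPdist_le _ _ _ (nbhs u)) => e e0.
have c0 : 0 < Num.sqrt n%:R + 1 :> R by rewrite ltr_wpDl ?sqrtr_ge0.
have /cvgrPdist_le/(_ _ (divr_gt0 e0 c0)) uU : v @[v --> u] --> u by exact: cvg_id.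
apply: (@filterS _ (nbhs u)) uU => v uv.
have : enorm (u - v) <= e.
  rewrite (le_trans (enorm_le_normr _))// (le_trans (ler_wpM2l (sqrtr_ge0 _) uv))//.
  by rewrite mulrCA ger_pMr// ler_pdivrMr// mul1r lerDl.
apply: le_trans; rewrite ler_norml; apply/andP; split.
  by have := enormD (v - u) u; rewrite subrK enormB; lra.
by have := enormD (u - v) v; rewrite subrK; lra.
Qed.

Section Convergence.
Context {T : Type} {F : set_system T} {FF : Filter F}.

Lemma cvg_enorm n (u : T -> 'cV[R]_n) l :
  u @ F --> l -> (fun k => enorm (u k)) @ F --> enorm l.
Proof. by move=> ul; apply: continuous_cvg => //; exact: enorm_continuous. Qed.

Lemma enorm_cvg n (u : T -> 'cV[R]_n) l :
  (fun k => enorm (u k - l)) @ F --> (0 : R) -> u @ F --> l.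
Proof.
move=> /cvgr0Pnorm_le ul; apply/cvgrPdist_le => e e0.
near=> k; rewrite distrC (le_trans (normr_le_enorm _))//.
rewrite -[leLHS]ger0_norm ?enorm_ge0//; near: k; exact: ul.
Unshelve. all: by end_near. Qed.

Lemma enorm_sqr_cvg n (u : T -> 'cV[R]_n) :
  (fun k => enorm (u k) ^+ 2) @ F --> (0 : R) -> u @ F --> (0 : 'cV[R]_n).
Proof.
move=> u0; apply: enorm_cvg.
have -> : (fun k => enorm (u k - 0)) = Num.sqrt \o (fun k => enorm (u k) ^+ 2).
  by apply/funext => k /=; rewrite subr0 sqrtr_sqr ger0_norm ?enorm_ge0.
by rewrite -[X in _ --> X]sqrtr0; apply: continuous_cvg => //; exact: sqrt_continuous.
Qed.

Lemma cvg_dotp n (u v : T -> 'cV[R]_n) l m : u @ F --> l -> v @ F --> m ->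
  (fun k => dotp (u k) (v k)) @ F --> dotp l m.
Proof.
(* Polarization. *)
have E a b : dotp a b =
    (enorm (a + b) * enorm (a + b) - enorm (a - b) * enorm (a - b)) / 4 :> R.
  by rewrite -!expr2 !enorm_sqr !dotpE (dotpC b a); field.
move=> ul vm; rewrite E (_ : (fun k => _) =
  (fun k => (enorm (u k + v k) * enorm (u k + v k) -
    enorm (u k - v k) * enorm (u k - v k)) / 4)); last by apply/funext => k; rewrite E.
apply: cvgM; last exact: cvg_cst.
have D := cvg_enorm (cvgD ul vm); have B := cvg_enorm (cvgB ul vm).
by apply: cvgB; apply: cvgM; (exact: D || exact: B).
Qed.

End Convergence.

Lemma opnorm_has_ubound m n (A : 'M[R]_(m, n)) :
  has_ubound [set enorm (A *m x) | x in [set x : 'cV[R]_n | enorm x <= 1]].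
Proof.
(* Cauchy-Schwarz on each row bounds |A x|^2 by the sum [c] of the squared row norms, and c <= (1 +
   c)^2. *)
exists (1 + \sum_(i < m) enorm (row i A)^T ^+ 2) => _ [x /= x1 <-].
set c := \sum_(i < m) _; have c0 : 0 <= c by apply: sumr_ge0 => i _; exact: sqr_ge0.
rewrite enorm_leP; last lra.
apply: (@le_trans _ _ c); last nra.
apply: ler_sum => i _; rewrite -expr2.
have -> : (A *m x) i 0 = dotp (row i A)^T x.
  by rewrite mxE; apply: eq_bigr => j _; rewrite !mxE.
rewrite -[leLHS]ger0_norm ?sqr_ge0// normrX ler_sqr ?nnegrE ?enorm_ge0//.
by rewrite (le_trans (normr_dotp _ _))// ler_piMr ?enorm_ge0.
Qed.

Lemma opnorm_ge0 m n (A : 'M[R]_(m, n)) : 0 <= opnorm A.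
Proof.
apply: (ub_le_sup (opnorm_has_ubound A)).
by exists 0; rewrite /= ?mulmx0 enorm0 ?ler01.
Qed.

Lemma opnorm_ub m n (A : 'M[R]_(m, n)) u : enorm (A *m u) <= opnorm A * enorm u.
Proof.
have [/enorm_eq0 ->|u0] := eqVneq (enorm u) 0.
  by rewrite mulmx0 !enorm0 mulr0.
have {}u0 : 0 < enorm u by rewrite lt0r u0 enorm_ge0.
rewrite -ler_pdivrMr//.
have -> : enorm (A *m u) / enorm u = enorm (A *m ((enorm u)^-1 *: u)).
  by rewrite -scalemxAr enormZ gtr0_norm ?invr_gt0// mulrC.
apply: ub_le_sup; first exact: opnorm_has_ubound.
exists ((enorm u)^-1 *: u) => //=.
by rewrite enormZ gtr0_norm ?invr_gt0// mulVf// gt_eqF.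
Qed.

Lemma cvg_mulmx T (F : set_system T) {FF : Filter F} m n (A : 'M[R]_(m, n))
    (u : T -> 'cV[R]_n) l :
  u @ F --> l -> (fun k => A *m u k) @ F --> A *m l.
Proof.
move=> ul; apply: enorm_cvg.
apply: (@squeeze_cvgr _ _ _ _ (fun=> 0) (fun k => opnorm A * enorm (u k - l))).
- by apply: nearW => k; rewrite enorm_ge0 -mulmxBr opnorm_ub.
- exact: cvg_cst.
- rewrite -[X in _ --> X](mulr0 (opnorm A)); apply: cvgM; first exact: cvg_cst.
  rewrite -(enorm0 n) -(subrr l); apply: cvg_enorm.
  by apply: cvgB => //; exact: cvg_cst.
Qed.

(** Compactness is obtained for row vectors and carried over by transposition, which is
    continuous. *)
Lemma closed_ball_compact n (w : 'cV[R]_n) r : compact [set v | enorm (v - w) <= r].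
Proof.
pose B := [set v : 'rV[R]_n | enorm (v^T - w) <= r].
have trc : continuous (fun v : 'rV[R]_n => v^T : 'cV[R]_n).
  move=> v; apply/(@cvgrPdist_le _ _ _ (nbhs v)) => e e0.
  have /cvgrPdist_le/(_ _ e0) vV : t @[t --> v] --> v by exact: cvg_id.
  apply: (@filterS _ (nbhs v)) vV => t; apply: le_trans.
  rewrite -linearB/= [leLHS]/Num.Def.normr/= mx_normrE; apply/bigmax_leP; split => //.
  move=> [i j] _ /=; rewrite mxE [leRHS]/Num.Def.normr/= mx_normrE.
  by apply/bigmax_geP; right; exists (j, i).
have cB : compact B.
  apply: bounded_closed_compact.
    exists (enorm w + r); split; first exact: num_real.
    move=> M rM v /= vB; apply: (@le_trans _ _ (`|v^T|)).
      rewrite {1}/Num.Def.normr/= mx_normrE; apply/bigmax_leP; split => //.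
      move=> [i j] _ /=; rewrite [leRHS]/Num.Def.normr/= mx_normrE.
      by apply/bigmax_geP; right; exists (j, i) => //=; rewrite mxE.
    rewrite (le_trans (normr_le_enorm _))//.
    by have := enormD (v^T - w) w; rewrite subrK => H; rewrite /B/= in vB; lra.
  have -> : B = (fun v : 'rV[R]_n => enorm (v^T - w)) @^-1` [set t | t <= r] by [].
  refine (preimage_closed _ (@closed_le _ r)) => v _.
  exact: (cvg_enorm (cvgB (trc v) (cvg_cst w))).
have -> : [set v | enorm (v - w) <= r] = trmx @` B.
  apply/seteqP; split => [v vB|_ [v vB <-]//].
  by exists v^T; rewrite /B/= ?trmxK.
by apply: continuous_compact => //; exact: continuous_subspaceT.
Qed.

End EuclideanSpace.

(** * Convex functions and conjugates *)

Section ConvexAnalysis.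
Set Implicit Arguments.
Unset Strict Implicit.
Context {R : realType}.

(** The sets of points of [C] where [h] is at most h v, for v in [C], generate a filter; [p] is one
    of its cluster points. If h v < h p, a real level between them and semicontinuity give a
    neighbourhood of [p] that misses the set of v. *)
Lemma lsc_compact_min (T : topologicalType) (h : T -> \bar R) (C : set T) :
  lower_semicontinuous h -> compact C -> C !=set0 ->
  exists2 p, C p & forall v, C v -> (h p <= h v)%E.
Proof.
move=> hlsc Ccpt [c0 Cc0].
pose F := filter_from C (fun v => [set u | C u /\ (h u <= h v)%E]).
have FF : ProperFilter F.
  apply: filter_from_proper; last by move=> v Cv; exists v.
  apply: filter_from_filter; first by exists c0.
  move=> i j Ci Cj; have [ij|ji] := leP (h i) (h j).
    by exists i => // u [Cu ui]; split; split => //; exact: le_trans ij.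
  by exists j => // u [Cu uj]; split; split => //; exact: le_trans (ltW ji).
have FC : F C by exists c0 => // u [].
have [p [Cp clp]] := Ccpt F FF FC.
exists p => // v Cv; rewrite leNgt; apply/negP => vp.
have : exists2 a : R, (h v <= a%:E)%E & (a%:E < h p)%E.
  move: vp; case: (h v) => [a| |]; case: (h p) => [b| |]//.
  - by move=> ab; exists a.
  - by move=> _; exists a => //; exact: ltry.
  - by move=> _; exists (b - 1); rewrite ?leNye// lte_fin; lra.
  - by move=> _; exists 0; rewrite ?leNye// ltry.
move=> [a va /hlsc[V Vp aV]].
have [|u [[_ uv] /aV]] := clp [set u | C u /\ (h u <= h v)%E] V _ Vp.
  by exists v.
by rewrite ltNge (le_trans uv va).
Qed.

Lemma lscD (T : topologicalType) (h : T -> \bar R) (c : T -> R) :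
  lower_semicontinuous h -> continuous c ->
  lower_semicontinuous (fun v => h v + (c v)%:E)%E.
Proof.
move=> hlsc cc v a av.
(* The level [a] is split as b + (a - b), with b < h v and a - b < c v. *)
have [b bv abc] : exists2 b : R, (b%:E < h v)%E & a - c v < b.
  move: av; case: (h v) => [x| |]//.
  - rewrite -EFinD lte_fin => ?.
    by exists ((a - c v + x) / 2); rewrite ?lte_fin; lra.
  - by move=> _; exists (a - c v + 1); rewrite ?ltry//; lra.
have [V Vv bV] := hlsc _ _ bv.
exists (V `&` [set u | a - b < c u]).
  apply: filterI => //; apply: (cvgr_gt (c v)); first exact: cc.
  lra.
move=> u [/bV bu /= abu]; move: bu; case: (h u) => [x| |]//.
  by rewrite -EFinD !lte_fin; lra.
by move=> _; rewrite addye ?ltry.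
Qed.

Lemma proper_efun_fin n (h : 'cV[R]_n -> \bar R) v :
  proper_efun h -> (h v < +oo)%E -> exists b : R, h v = b%:E.
Proof.
by move=> [hN _]; have := hN v; case: (h v) => [b _ _| |]//; exists b.
Qed.

Lemma conjugate_ge n (h : 'cV[R]_n -> \bar R) v q a : h v = a%:E ->
  ((dotp q v - a)%:E <= conjugate h q)%E.
Proof. by move=> hv; apply: ereal_sup_ubound; exists v => //; rewrite hv. Qed.

Lemma conjugate_le n (h : 'cV[R]_n -> \bar R) q k : proper_efun h ->
  (forall v a, h v = a%:E -> dotp q v - a <= k) -> (conjugate h q <= k%:E)%E.
Proof.
move=> hp H; apply: ge_ereal_sup => _ [v _ <-].
have := hp.1 v; case E : (h v) => [a| |]// _; last by rewrite leNye.
by rewrite -EFinB lee_fin H.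
Qed.

Lemma conjugate_gtNy n (h : 'cV[R]_n -> \bar R) q : proper_efun h ->
  (-oo < conjugate h q)%E.
Proof.
move=> hp; have [v /(proper_efun_fin hp) [a hv]] := hp.2.
exact: lt_le_trans (ltNyr _) (conjugate_ge q hv).
Qed.

(* [p] needs to be minimal only locally along each ray, so that the lemma also
   covers interior minimizers over a ball. *)
Lemma prox_optimality n (h : 'cV[R]_n -> \bar R) p w c a u b :
  convex_efun h -> 0 <= c -> h p = a%:E -> h u = b%:E ->
  (exists2 tau, 0 < tau & forall t, 0 < t -> t < tau ->
    ((a + c / 2 * enorm (p - w) ^+ 2)%:E <= h (p + t *: (u - p))%R +
     (c / 2 * enorm (p + t *: (u - p) - w) ^+ 2)%:E)%E) ->
  a + c * dotp (w - p) (u - p) <= b.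
Proof.
move=> hconv c0 hp hu [tau tau0 H]; rewrite leNgt; apply/negP => D.
pose e := a + c * dotp (w - p) (u - p) - b.
have e0 : 0 < e by rewrite /e; lra.
pose N := c * enorm (u - p) ^+ 2 + 1.
have N0 : 0 < N by rewrite /N ltr_wpDl// mulr_ge0// sqr_ge0.
(* The first two bounds allow convexity and the local minimality; t N <= e keeps the quadratic term,
   of order t^2, below the first-order gap t e. *)
pose t := Num.min (1 / 2) (Num.min (tau / 2) (e / N)).
have t0 : 0 < t by rewrite !lt_min !divr_gt0.
have t1 : t < 1 by rewrite gt_min; apply/orP; left; lra.
have tt : t < tau by rewrite !gt_min; apply/orP; right; apply/orP; left; lra.
have tN : t * N <= e.
  by rewrite -ler_pdivlMr// !ge_min lexx !orbT.
have := H t t0 tt; have := hconv u p t t0 t1.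
have -> : t *: u + (1 - t) *: p = p + t *: (u - p).
  by rewrite scalerBr scalerBl scale1r addrCA addrC -!addrA.
rewrite hp hu -!EFinM -EFinD; case: (h _) => [x| |]//.
rewrite -EFinD !lee_fin !enorm_sqr => xle.
have -> : p + t *: (u - p) - w = (p - w) + t *: (u - p) by rewrite addrAC.
have : dotp (p - w) (u - p) = - dotp (w - p) (u - p) by rewrite -dotpNl opprB.
move: tN D; rewrite /N /e enorm_sqr.
move: (p - w) (u - p) (dotp (w - p) _) xle => y z s xle tN D ys.
rewrite !dotpE (dotpC z y) ys; move: tN; set q := dotp z z => tN H2.
have H3 : t * (a + c * s - b - t / 2 * (c * q)) <= 0 by nra.
have : a + c * s - b - t / 2 * (c * q) <= 0 by rewrite -(pmulr_rle0 _ t0).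
have : 0 <= t * (c * q) by rewrite !mulr_ge0 ?dotp_ge0 ?(ltW t0).
lra.
Qed.

(* The minorant is the tangent at a proximal point of [w] close to [w]. *)
Lemma affine_minorant n (h : 'cV[R]_n -> \bar R) w a e :
  proper_efun h -> convex_efun h -> lower_semicontinuous h ->
  h w = a%:E -> 0 < e ->
  exists q (k : R), (conjugate h q <= k%:E)%E /\ a - e <= dotp q w - k.
Proof.
move=> hp hconv hlsc hw e0.
have ae : ((a - e)%:E < h w)%E by rewrite hw lte_fin; lra.
have [V /(nbhs_ballP w)[d /= d0 dV] aV] := hlsc _ _ ae.
pose B := [set v : 'cV[R]_n | enorm (v - w) <= 1].
have Bw : B w by rewrite /B/= subrr enorm0.
have [p0 Bp0 p0min] := lsc_compact_min hlsc
  (closed_ball_compact (w:=w) (r:=1)) (ex_intro _ w Bw).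
have [m hp0] : exists m : R, h p0 = m%:E.
  by apply: (proper_efun_fin hp); rewrite (le_lt_trans (p0min _ Bw))// hw ltry.
have ma : m <= a by have := p0min _ Bw; rewrite hp0 hw lee_fin.
pose d1 := Num.min d 1; have d10 : 0 < d1 by rewrite lt_min d0 ltr01.
(* So that c/2 d1^2 = a - m + 1: since h p >= m and h p + c/2 |p - w|^2 <= a, the proximal point is
   within [d1] of [w]. *)
pose c := 2 * (a - m + 1) / d1 ^+ 2.
have c0 : 0 < c by rewrite divr_gt0 ?exprn_gt0// mulr_gt0//; lra.
have cc : continuous (fun v : 'cV[R]_n => c / 2 * enorm (v - w) ^+ 2).
  move=> v; have D : (fun u => enorm (u - w)) @ nbhs v --> enorm (v - w).
    exact: (cvg_enorm (cvgB cvg_id (cvg_cst w))).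
  exact: (cvgM (cvg_cst _) (cvgM D D)).
have [p Bp pmin] := lsc_compact_min (lscD hlsc cc)
  (closed_ball_compact (w:=w) (r:=1)) (ex_intro _ w Bw).
have := pmin _ Bw; rewrite hw subrr enorm0 expr0n/= mulr0 adde0 => pw.
have [b hpb] : exists b : R, h p = b%:E.
  apply: (proper_efun_fin hp); move: pw; case: (h p) => [b| |]//=.
  by move=> _; exact: ltry.
have mb : m <= b by have := p0min _ Bp; rewrite hp0 hpb lee_fin.
move: pw; rewrite hpb -EFinD lee_fin => pw.
have pd : enorm (p - w) < d1.
  rewrite -ltr_sqr ?nnegrE ?enorm_ge0 ?ltW//.
  have : c / 2 * enorm (p - w) ^+ 2 < c / 2 * d1 ^+ 2.
    have -> : c / 2 * d1 ^+ 2 = a - m + 1.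
      by rewrite /c; field; rewrite gt_eqF.
    lra.
  by rewrite ltr_pM2l// divr_gt0.
have bV : a - e < b.
  rewrite -lte_fin -hpb; apply/aV/dV; rewrite -ball_normE/=.
  rewrite distrC (le_lt_trans (normr_le_enorm _))//.
  by rewrite (lt_le_trans pd)// ge_min lexx.
(* [p] minimizes only over the unit ball around [w], but it is interior to it, so short moves
   towards [u] stay in the ball. *)
have sub u x : h u = x%:E -> b + c * dotp (w - p) (u - p) <= x.
  move=> hu; apply: (prox_optimality hconv (ltW c0) hpb hu).
  have p1 : enorm (p - w) < 1 by rewrite (lt_le_trans pd)// ge_min lexx orbT.
  pose M := enorm (u - p) + 1; have M0 : 0 < M by rewrite /M ltr_wpDl ?enorm_ge0.
  exists ((1 - enorm (p - w)) / M); first by rewrite divr_gt0// subr_gt0.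
  move=> t t0 tM.
  have Bt : B (p + t *: (u - p)).
    rewrite /B/= addrAC (le_trans (enormD _ _))// enormZ gtr0_norm//.
    move: tM; rewrite ltr_pdivlMr// /M => tM.
    by have := enorm_ge0 (u - p); nra.
  by have := pmin _ Bt; rewrite hpb.
exists (c *: (w - p)), (dotp (c *: (w - p)) p - b); split.
  apply: conjugate_le => // v x /sub.
  by rewrite dotpDr dotpNr !dotpZl; lra.
have : 0 <= c * dotp (w - p) (w - p) by rewrite mulr_ge0 ?dotp_ge0 ?ltW.
by rewrite !dotpE; lra.
Qed.

Lemma conjugate_proper n (h : 'cV[R]_n -> \bar R) :
  proper_efun h -> convex_efun h -> lower_semicontinuous h ->
  proper_efun (conjugate h).
Proof.
move=> hp hc hl; split=> [q|]; first exact: conjugate_gtNy.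
have [w /(proper_efun_fin hp)[a hw]] := hp.2.
have [q [k [qk _]]] := affine_minorant hp hc hl hw ltr01.
by exists q; exact: le_lt_trans qk (ltry _).
Qed.

Lemma conjugate_convex n (h : 'cV[R]_n -> \bar R) :
  proper_efun h -> convex_efun (conjugate h).
Proof.
move=> hp x y t t0 t1.
have := conjugate_gtNy x hp; have := conjugate_gtNy y hp.
case Ex : (conjugate h x) => [a| |]//; case Ey : (conjugate h y) => [b| |]// _ _.
- rewrite -!EFinM -EFinD; apply: conjugate_le => // v c hv.
  have := conjugate_ge x hv; have := conjugate_ge y hv.
  rewrite Ex Ey !lee_fin !dotpE; nra.
- by rewrite gt0_muley ?addey ?leey// lte_fin subr_gt0.
- by rewrite gt0_muley ?addye ?leey// lte_fin.
- by rewrite !gt0_muley ?leey ?lte_fin ?subr_gt0.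
Qed.

(** Real form of w \in \partial h(p) for proper [h]: points where [h] is infinite impose no
    constraint. *)
Definition fin_subgradient n (h : 'cV[R]_n -> \bar R) (w p : 'cV[R]_n) : Prop :=
  exists2 a : R, h p = a%:E & forall u b, h u = b%:E -> a + dotp w (u - p) <= b.

Lemma Prox_subgradient n (h : 'cV[R]_n -> \bar R) c w p :
  proper_efun h -> convex_efun h -> 0 < c -> Prox h (1 / c) w p ->
  fin_subgradient h (c *: (w - p)) p.
Proof.
move=> hp hc c0 pmin.
have E : 1 / (2 * (1 / c)) = c / 2 by field; rewrite gt_eqF.
have [u0 /(proper_efun_fin hp)[b0 hu0]] := hp.2.
have [a ha] : exists a : R, h p = a%:E.
  apply: (proper_efun_fin hp); have := pmin u0; rewrite hu0.
  by have := hp.1 p; case: (h p) => [a| |]//= _ _; exact: ltry.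
exists a => // u b hu; rewrite dotpZl; apply: (prox_optimality hc (ltW c0) ha hu).
exists 1 => // t _ _; have := pmin (p + t *: (u - p)).
by rewrite ha E -EFinD.
Qed.

(** The converse of the Fenchel-Young inequality. Biconjugation is replaced by an affine minorant
    exact at [w] up to [e]: its slope [q] is inserted in the subgradient inequality of the conjugate
    at [z]. *)
Lemma fenchel_equality n (h : 'cV[R]_n -> \bar R) w a z b :
  proper_efun h -> convex_efun h -> lower_semicontinuous h ->
  h w = a%:E -> conjugate h z = b%:E ->
  fin_subgradient (conjugate h) w z -> a + b <= dotp z w.
Proof.
move=> hp hc hl hw hz [b']; rewrite hz => -[<-] sub; apply/ler_addgt0Pr => e e0.
have [q [k [qk ak]]] := affine_minorant hp hc hl hw e0.
have [c hq] : exists c : R, conjugate h q = c%:E.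
  apply: (proper_efun_fin (conjugate_proper hp hc hl)).
  exact: le_lt_trans qk (ltry _).
have := sub _ _ hq; move: qk; rewrite hq lee_fin dotpDr dotpNr.
rewrite (dotpC w q) (dotpC w z); lra.
Qed.

End ConvexAnalysis.

(** * Functions with Lipschitz gradient *)

Section Smooth.
Set Implicit Arguments.
Unset Strict Implicit.
Context {R : realType}.

Lemma diff_gradient n (phi : 'cV[R]_n -> R) x v : differentiable phi x ->
  'd phi x v = dotp (gradient phi x) v.
Proof.
move=> dphi.
have -> : v = \sum_(i < n) v i 0 *: delta_mx i 0.
  apply/colP => j; rewrite summxE (bigD1 j)//= big1 => [|i ij].
    by rewrite !mxE !eqxx mulr1 addr0.
  by rewrite !mxE eq_sym (negbTE ij) mulr0.
rewrite linear_sum /dotp; apply: eq_bigr => i _.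
rewrite linearZ/= mxE summxE (bigD1 i)//= big1 => [|j ji].
  by rewrite !mxE !eqxx mulr1 addr0 mulrC.
by rewrite !mxE eq_sym (negbTE ji) mulr0.
Qed.

(** Mean value theorem for [psi], which is [phi] along the segment minus the linear and quadratic
    terms of the bound; the Lipschitz condition makes its derivative nonpositive. *)
Lemma descent_lemma n (phi : 'cV[R]_n -> R) l u v :
  (forall x, differentiable phi x) ->
  (forall x u, enorm (gradient phi x - gradient phi u) <= l * enorm (x - u)) ->
  phi v <= phi u + dotp (gradient phi u) (v - u) + l / 2 * enorm (v - u) ^+ 2.
Proof.
move=> dphi lip; set d := v - u; set s := dotp _ d; set q := enorm d ^+ 2.
pose L (t : R) := u + t *: d.
pose psi (t : R) : R := phi (L t) - (t * s + l / 2 * q * t ^+ 2).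
have dpsi (t : R) : is_derive t 1 psi
    (dotp (gradient phi (L t)) d - (s + l / 2 * q * (2 * t))).
  have dL : is_diff t (phi \o L) ('d phi (L t) \o (fun h => h *: d)).
    have : is_diff t L (fun h : R => h *: d).
      rewrite -[X in is_diff _ _ X]add0r; exact: is_diffD.
    move=> ?; have : is_diff (L t) phi ('d phi (L t)) by apply: DiffDef.
    move=> ?; exact: is_diff_comp.
  have d1 : is_derive t 1 (phi \o L) (dotp (gradient phi (L t)) d).
    apply: DeriveDef; first by apply: diff_derivable; exact: ex_diff.
    by rewrite deriveE ?diff_val/= ?scale1r ?diff_gradient//; exact: ex_diff.
  have d2 : is_derive t 1 (fun t : R => t * s + l / 2 * q * t ^+ 2)
      (s + l / 2 * q * (2 * t)).
    apply: is_derive_eq.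
    by rewrite /GRing.scale/=; ring.
  exact: (@is_deriveB _ _ _ _ _ _ _ _ _ d1 d2).
have cpsi : {within `[0, 1], continuous psi}.
  apply: continuous_subspaceT => t; apply: differentiable_continuous.
  by apply/derivable1_diffP; have [] := dpsi t.
have [c] := MVT_segment ler01 (fun t _ => dpsi t) cpsi.
rewrite in_itv/= => /andP[c0 c1]; rewrite subr0 mulr1 /psi /L.
rewrite scale1r scale0r addr0 (_ : u + d = v); last by rewrite /d addrC subrK.
rewrite !mul0r expr0n/= mulr0 addr0 subr0 mul1r expr1n mulr1 => E.
have := lip (u + c *: d) u; move: E; rewrite /s.
(* Unification between values of [gradient phi] would unfold the differential. *)
move: (gradient phi) (phi v) (phi u) => D a b E; rewrite (addrC u) addrK => lipD.
have : dotp (D (c *: d + u) - D u) d <= l * c * q.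
  rewrite (le_trans (dotp_le_enorm _ _))// /q expr2 mulrA ler_wpM2r ?enorm_ge0//.
  by move: lipD; rewrite enormZ ger0_norm// mulrA.
rewrite dotpDl dotpNl; move: E; rewrite (addrC u) /q.
move: (dotp (D (c *: d + u)) d) (dotp (D u) d) (enorm d ^+ 2) => x y e; lra.
Qed.

End Smooth.

(** * Boundedness of the dual iterates *)

Section DualBound.
Set Implicit Arguments.
Unset Strict Implicit.
Context {R : realType}.

(** Let t tend to 0. This lemma and the next read off the position of a point of a ball that leaves
    it under every move t > 0 in a fixed direction. *)
Lemma quadratic_gt_const (e a b c : R) : 0 <= c ->
  (forall t, 0 < t -> e < a + 2 * t * b + t ^+ 2 * c) -> e <= a.
Proof.
move=> c0 H; rewrite leNgt; apply/negP => ae.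
pose M := 2 * `|b| + c + 1.
have M0 : 0 < M by have := normr_ge0 b; rewrite /M; lra.
pose t := Num.min 1 ((e - a) / M).
have t0 : 0 < t by rewrite lt_min ltr01 divr_gt0// subr_gt0.
have t1 : t <= 1 by rewrite ge_min lexx.
have tM : t * M <= e - a by rewrite -ler_pdivlMr// ge_min lexx orbT.
have := H t t0; have := ler_norm b; move: tM; rewrite /M.
have : t ^+ 2 * c <= t * c by rewrite expr2 -mulrA ler_piMl// mulr_ge0// ltW.
nra.
Qed.

Lemma quadratic_gt_slope (e a b c : R) : 0 <= c -> a <= e ->
  (forall t, 0 < t -> e < a + 2 * t * b + t ^+ 2 * c) -> 0 <= b.
Proof.
move=> c0 ae H; rewrite leNgt; apply/negP => b0.
(* Close to the minimizer -b/c of the quadratic, and defined also when c = 0. *)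
pose t := - b / (c + 1).
have t0 : 0 < t by rewrite divr_gt0//; lra.
have tc : t * (c + 1) = - b by rewrite divfK//; lra.
have := H t t0; nra.
Qed.

(* [p] minimizes [g - <z', .>] on the ball.  If [l < |z'|] then, the slopes of
   [g] on the ball being at most [l], a point of the ball that does at least as
   well as [p] leaves the ball when it is moved along [z'].  Hence [p] is on the
   sphere, [<p - u, z'> >= 0], and (moving from [p] towards [w], a minimizer over
   the whole space) [<p - u, w - p> >= 0]; this contradicts [a * l < r]. *)
Lemma prox_dual_bound n (g : 'cV[R]_n -> \bar R) u r l a c z z' :
  proper_efun g -> convex_efun g -> lower_semicontinuous g ->
  0 < r -> 0 < l -> 0 < a -> 0 < c -> a * l < r ->
  (forall v, enorm (v - u) <= r -> (g v < +oo)%E) ->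
  is_lipschitz_on g [set v | enorm (v - u) <= r] l ->
  enorm z <= l -> fin_subgradient (conjugate g) (u + a *: z - c *: z') z' ->
  enorm z' <= l.
Proof.
move=> gp gc gl r0 l0 a0 c0 alr gfin lip zl [b gz' sub].
rewrite leNgt; apply/negP => lz'.
have [w wE] : exists w, w = u + a *: z - c *: z' by exists (u + a *: z - c *: z').
rewrite -wE in sub.
have cdot : continuous (fun v : 'cV[R]_n => - dotp z' v).
  move=> v; have D : dotp z' t @[t --> v] --> dotp z' v.
    by apply: (@cvg_dotp _ _ (nbhs v)); [exact: cvg_cst|exact: cvg_id].
  exact: (cvgN D).
have Bu : enorm (u - u) <= r by rewrite subrr enorm0 ltW.
have [p Bp pmin] := lsc_compact_min (lscD gl cdot)
  (closed_ball_compact (w:=u) (r:=r)) (ex_intro _ u Bu).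
have [x0 gx0] := proper_efun_fin gp (gfin _ Bp).
(* The right-hand side is |p' + t z' - u|^2. If the moved point stayed in the ball, the linear term
   would gain t |z'|^2 while [g] grows by at most l t |z'|, which contradicts the minimality of
   [p]. *)
have star p' x' t : enorm (p' - u) <= r -> g p' = x'%:E ->
    x' - dotp z' p' <= x0 - dotp z' p -> 0 < t ->
    r ^+ 2 < dotp (p' - u) (p' - u) + 2 * t * dotp (p' - u) z' + t ^+ 2 * dotp z' z'.
  move=> Bp' gp' pp' t0.
  have -> : dotp (p' - u) (p' - u) + 2 * t * dotp (p' - u) z' + t ^+ 2 * dotp z' z'
      = enorm (p' + t *: z' - u) ^+ 2.
    rewrite enorm_sqr (addrAC p'); move: (p' - u) => d.
    by rewrite !dotpE (dotpC z' d); ring.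
  rewrite ltr_sqr ?nnegrE ?enorm_ge0 ?(ltW r0)// ltNge; apply/negP => Bt.
  have [x1 gx1] := proper_efun_fin gp (gfin _ Bt).
  have := pmin _ Bt; rewrite gx0 gx1 -!EFinD lee_fin dotpDr dotpZr => H1.
  have := lip _ _ Bt Bp'; rewrite gx1 gp' -EFinB abse_EFin lee_fin addrAC subrr add0r.
  rewrite enormZ (gtr0_norm t0) ler_norml => /andP[_ H2].
  move: H1; rewrite -enorm_sqr => H1.
  have : t * enorm z' * (enorm z' - l) > 0.
    by rewrite !mulr_gt0// ?subr_gt0//; apply: lt_trans lz'.
  nra.
have [Np Dp] : r ^+ 2 <= dotp (p - u) (p - u) /\ dotp (p - u) (p - u) <= r ^+ 2.
  split; last by rewrite -enorm_leP// ltW.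
  apply: (@quadratic_gt_const _ _ (dotp (p - u) z') _ (dotp_ge0 z')) => t t0.
  exact: star gx0 _ _.
have pz' : 0 <= dotp (p - u) z'.
  apply: (quadratic_gt_slope (dotp_ge0 z') Dp) => t t0.
  exact: star gx0 _ _.
(* Otherwise a short move from [p] towards [w] gives a point [p'] strictly inside the ball and doing
   at least as well as [p], against [star]. *)
have pw : 0 <= dotp (p - u) (w - p).
  rewrite leNgt; apply/negP => m0.
  pose W := dotp (w - p) (w - p); have W0 : 0 <= W by exact: dotp_ge0.
  pose t := Num.min (1 / 2) (- dotp (p - u) (w - p) / (W + 1)).
  have t0 : 0 < t by rewrite lt_min !divr_gt0//; lra.
  have t1 : t < 1 by rewrite gt_min; apply/orP; left; lra.
  have tW : t * (W + 1) <= - dotp (p - u) (w - p).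
    by rewrite -ler_pdivlMr ?ge_min ?lexx ?orbT//; lra.
  pose p' := p + t *: (w - p).
  have p'u : dotp (p' - u) (p' - u) < r ^+ 2.
    rewrite /p' (addrAC p); move: tW m0 Dp; rewrite /W.
    move: (p - u) (w - p) => d e tW m0 Dp; rewrite !dotpE (dotpC e d).
    have : t * (t * (dotp e e + 1)) <= t * - dotp d e by rewrite ler_pM2l.
    have : 0 < t * - dotp d e by rewrite mulr_gt0// oppr_gt0.
    nra.
  have Bp' : enorm (p' - u) <= r by rewrite enorm_leP ltW.
  have [x' gx'] := proper_efun_fin gp (gfin _ Bp').
  (* No value of [g] at [w] is used: an affine minorant nearly exact at [p'] lies below g(p) at [p]
     ([h4]) and below <z', w> - g^*(z') at [w] by the subgradient inequality ([h5]). *)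
  suff le' : x' - dotp z' p' <= x0 - dotp z' p.
    have : r ^+ 2 <= dotp (p' - u) (p' - u).
      apply: (@quadratic_gt_const _ _ (dotp (p' - u) z') _ (dotp_ge0 z')) => s s0.
      exact: star gx' _ _.
    by rewrite leNgt p'u.
  apply/ler_addgt0Pr => e e0.
  have [q [k [qk xk]]] := affine_minorant gp gc gl gx' e0.
  have [k' gq] : exists k' : R, conjugate g q = k'%:E.
    apply: (proper_efun_fin (conjugate_proper gp gc gl)).
    exact: le_lt_trans qk (ltry _).
  have := sub _ _ gq; have := conjugate_ge q gx0; have := conjugate_ge z' gx0.
  move: qk xk; rewrite gq gz' !lee_fin /p' !dotpDr !dotpZr !dotpDr !dotpNr.
  rewrite (dotpC w q) (dotpC w z').
  move: (dotp q p) (dotp q w) (dotp z' p) (dotp z' w) => qp qw zp zw.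
  move=> qk xk h1 h2 h3.
  have h4 : (1 - t) * (qp - x0 - k) <= 0 by rewrite pmulr_rle0; lra.
  have h5 : t * (b + qw - zw - k) <= 0 by rewrite pmulr_rle0; lra.
  have h6 : t * (zp - x0 - b) <= 0 by rewrite pmulr_rle0; lra.
  nra.
(* Hence 0 <= <p - u, w - p> <= a r l - r^2 < 0. *)
have : w - p = a *: z - c *: z' - (p - u).
  by rewrite wE; apply/colP => i; rewrite !mxE; ring.
move=> wp; move: pw; rewrite wp !dotpDr !dotpNr !dotpZr => pw.
have H1 : dotp (p - u) z <= r * l.
  rewrite (le_trans (dotp_le_enorm _ _))// ler_pM ?enorm_ge0//.
have H2 : 0 <= c * dotp (p - u) z' by rewrite mulr_ge0// ltW.
have H3 : a * dotp (p - u) z <= a * (r * l) by rewrite ler_pM2l.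
have : r * (a * l) < r * r by rewrite ltr_pM2l.
move: pw Np Dp; rewrite !dotpDr !dotpNr; lra.
Qed.

End DualBound.

(** * One step of the iteration *)

Section Iteration.
Set Implicit Arguments.
Unset Strict Implicit.
Context {R : realType}.

Lemma Proj_variational n (S : set 'cV[R]_n) w p u :
  convex_set S -> Proj S w p -> S u -> dotp (w - p) (u - p) <= 0.
Proof.
move=> Sc [Sp pmin] Su; rewrite leNgt; apply/negP => b0.
set b := dotp (w - p) (u - p) in b0.
pose q := dotp (u - p) (u - p); have q0 : 0 <= q by exact: dotp_ge0.
pose t := Num.min 1 (b / (q + 1)).
have t0 : 0 < t by rewrite lt_min ltr01 divr_gt0//; lra.
have t1 : t <= 1 by rewrite ge_min lexx.
have tq : t * (q + 1) <= b by rewrite -ler_pdivlMr ?ge_min ?lexx ?orbT//; lra.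
have St : S (t *: u + (1 - t) *: p).
  by have := Sc u p (Itv01 (ltW t0) t1); rewrite !inE; apply.
have := pmin _ St; rewrite enorm_leP ?enorm_ge0// enorm_sqr.
have -> : p - w = - (w - p) by rewrite opprB.
have -> : t *: u + (1 - t) *: p - w = t *: (u - p) - (w - p).
  by apply/colP => i; rewrite !mxE; ring.
have E v d : dotp (t *: d - v) (t *: d - v) =
    t ^+ 2 * dotp d d - 2 * t * dotp v d + dotp v v.
  by rewrite !dotpE (dotpC d v); ring.
rewrite E dotpNl dotpNr opprK -/b -/q => H.
have : t * (t * (q + 1)) <= t * b by rewrite ler_pM2l.
have : 0 < t * b by rewrite mulr_gt0.
nra.
Qed.

(** From [N] on, [V] decreases to a limit, and [d] is squeezed between 0 and the differences of
    consecutive values. *)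
Lemma decrement_cvg0 (V d : nat -> R) (N : nat) (m : R) :
  (forall k, (N <= k)%N -> 0 <= d k) ->
  (forall k, (N <= k)%N -> V k.+1 + d k <= V k) ->
  (forall k, (N <= k)%N -> m <= V k) ->
  d @ \oo --> (0 : R).
Proof.
move=> d0 Vd Vm; rewrite -(cvg_shiftn N).
pose W k := V (k + N)%N.
have W_cvg : cvgn W.
  apply: nonincreasing_is_cvgn.
    apply/nonincreasing_seqP => k; rewrite /W addSn.
    by have := Vd (k + N)%N (leq_addl _ _); have := d0 (k + N)%N (leq_addl _ _); lra.
  by exists m => _ [k _ <-]; exact/Vm/leq_addl.
apply: (@squeeze_cvgr _ _ _ _ (fun=> 0) (fun k => W k - W k.+1)).
- apply: nearW => k; rewrite d0 ?leq_addl//= /W addSn.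
  by have := Vd (k + N)%N (leq_addl _ _); lra.
- exact: cvg_cst.
- rewrite -(subrr (limn W)); apply: cvgB => //.
  by rewrite (cvg_shiftS W).
Qed.

(** Every success of the test advances [j]. Infinitely many successes would bring alpha k - al below
    eps / (l + 1), where the bound [l] on the iterates makes the test fail; l + 1 covers l = 0. *)
Lemma adaptive_alpha_frozen s (al gamma eps l : R) (z : nat -> 'cV[R]_s) alpha :
  0 < gamma -> 0 < eps -> 0 <= l -> (forall k, enorm (z k.+1) <= l) ->
  adaptive_alpha al gamma eps z alpha ->
  exists (N : nat) abar, [/\ al < abar, abar <= al + gamma &
    forall k, (N <= k)%N ->
      alpha k = abar /\ (abar - al) * enorm (z k.+1) <= eps].
Proof.
move=> gamma0 eps0 l0 zl [a [j [[acvg P1a] _ a0 j0 jS]]].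
pose test k := eps < (alpha k - al) * enorm (z k.+1).
have jmono k m : (k <= m)%N -> (j k <= j m)%N.
  move=> /subnK <-; elim: (m - k)%N => // i ih; rewrite addSn.
  by rewrite (leq_trans ih)// (jS _).2; case: ifP.
have a_gt i : al < a i.
  by case: i => [|i]; [rewrite a0 ltrDl|have [] := P1a i].
have [[N testN]|H] := pselect (exists N, forall k, (N <= k)%N -> ~~ test k).
  exists N, (alpha N); split; first by rewrite (jS N).1.
    rewrite (jS N).1 -a0; case: (j N) => // i; have [_ + _ _] := P1a i.+1.
    by [].
  have jN k : j (k + N)%N = j N.
    elim: k => // k ih; rewrite addSn (jS _).2 ifF//.
    by apply/negbTE; apply: testN; rewrite leq_addl.
  move=> k Nk; have E : alpha k = alpha N by rewrite !(jS _).1 -(subnK Nk) jN.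
  by split=> //; rewrite leNgt -E; exact: testN.
have {}H k0 : exists2 k, (k0 <= k)%N & test k.
  apply: contrapT => nk; apply: H; exists k0 => k kk0.
  by apply/negP => tk; apply: nk; exists k.
have junb i : exists k, (i <= j k)%N.
  elim: i => [|i [k ik]]; first by exists 0%N.
  have [m km tm] := H k; exists m.+1; rewrite (jS m).2 ifT//.
  by rewrite ltnS (leq_trans ik)// jmono.
have l10 : 0 < l + 1 by rewrite ltr_wpDl.
have /cvgrPdist_le/(_ _ (divr_gt0 eps0 l10))[M _ aM] := acvg.
have [k0 Mk0] := junb M.
have [k k0k] := H k0; rewrite /test ltNge => /negP[].
have := aM (j k) (leq_trans Mk0 (jmono _ _ k0k)); rewrite /= (jS k).1 distrC.
rewrite gtr0_norm ?subr_gt0// ler_pdivlMr// => aj.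
have : 0 < a (j k) - al by rewrite subr_gt0.
by have := zl k; have := enorm_ge0 (z k.+1); nra.
Qed.

(* The increments are [d = z' - z], [e = z - z_prev], [xi = A (x' - x)],
   [eta = K (x' - x)], [h = y' - y] and [D = |x' - x|^2]; [c = alpha_k - al] and
   [Q = 3 gamma / (2 c^2)].  The last two hypotheses on [G] are the two
   subgradient inequalities of [g^*]; their sum (monotonicity) is used with the
   multiplier [3 gamma / c - 1]. *)
Lemma lyapunov_step n p (z d e X xi : 'cV[R]_n) (y h Y eta : 'cV[R]_p)
    (phi phi' F F' G G' gD D sigma l al c Q beta mu rho : R) :
  0 < c -> 0 < Q -> 0 <= al -> c <= 2 / 3 * c ^+ 2 * Q -> al <= c ^+ 2 * Q / 3 ->
  rho = l / 2 + sigma * Q + mu ->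
  phi' <= phi + gD + l / 2 * D ->
  rho * D <= - gD + dotp y eta - dotp z xi ->
  F' + dotp (Y + eta - beta *: h) (- h) <= F ->
  dotp xi xi <= sigma * D ->
  G + dotp (X + al *: (z - e) - (c + al) *: z) d <= G' ->
  G' + dotp (X + xi + al *: z - (c + al) *: (z + d)) (- d) <= G ->
  phi' + F' - dotp (Y + eta) (y + h) + dotp (X + xi) (z + d) - G' -
    c / 2 * dotp (z + d) (z + d) + c * Q * al * dotp d d +
    (mu * D + beta * dotp h h + c ^+ 2 * Q / 3 * dotp d d)
  <= phi + F - dotp Y y + dotp X z - G - c / 2 * dotp z z + c * Q * al * dotp e e.
Proof.
move=> c0 Q0 al0 cQ alQ -> Hphi Hx Hy Hxi Hz Hz'.
(* [h1] bounds the cross term 2 c Q <xi, d>, [h4] charges its Q |xi|^2 to the part sigma Q of [rho],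
   and [h2] splits 2 c Q al <e, d> into telescoping squares. The remaining multiple of |d|^2 is the
   one in [h5]. *)
have h1 : 0 <= Q * dotp (xi - c *: d) (xi - c *: d).
  by rewrite mulr_ge0 ?dotp_ge0// ltW.
have h2 : 0 <= c * Q * al * dotp (e - d) (e - d).
  by rewrite !mulr_ge0 ?dotp_ge0// ltW.
have h4 : Q * dotp xi xi <= Q * (sigma * D) by rewrite ler_pM2l.
have h5 : 0 <= (2 / 3 * c ^+ 2 * Q - c / 2 - al) * dotp d d.
  by rewrite mulr_ge0 ?dotp_ge0//; lra.
have P1 : 1 <= 2 * c * Q.
  have : c * 1 <= c * (2 * c * Q) by lra.
  by rewrite ler_pM2l.
have h3 : 0 <= (2 * c * Q - 1) *
    (dotp xi d + al * dotp e d - (c + al) * dotp d d).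
  rewrite mulr_ge0 ?subr_ge0//; move: Hz Hz'.
  rewrite !dotpE; lra.
move: h1 h2 h3 h4 h5 Hphi Hx Hy Hz; rewrite !dotpE.
rewrite (dotpC d xi) (dotpC d e) (dotpC d z) (dotpC eta y) (dotpC xi z).
lra.
Qed.

End Iteration.

(** * Passing to the limit *)

Section Limits.
Set Implicit Arguments.
Unset Strict Implicit.
Context {R : realType}.

(** The values of the conjugate at p k are eliminated before the limit: <p k, v> - h v <= h^*(p k)
    <= h^*(u) - <w k, u - p k>, whose two ends are continuous in [p] and [w]. The supremum over v is
    taken afterwards. *)
Lemma conjugate_subgradient_cvg n (h : 'cV[R]_n -> \bar R)
    (w p : nat -> 'cV[R]_n) wb pb :
  proper_efun h -> convex_efun h -> lower_semicontinuous h ->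
  w @ \oo --> wb -> p @ \oo --> pb ->
  (forall k, fin_subgradient (conjugate h) (w k) (p k)) ->
  fin_subgradient (conjugate h) wb pb.
Proof.
move=> hp hc hl wcv pcv sub.
have main v a u b : h v = a%:E -> conjugate h u = b%:E ->
    dotp pb v - a <= b - dotp wb (u - pb).
  move=> hv hu.
  have cv : (fun k => dotp (p k) v + dotp (w k) (u - p k)) @ \oo -->
      dotp pb v + dotp wb (u - pb).
    apply: cvgD; first by apply: cvg_dotp => //; exact: cvg_cst.
    by apply: cvg_dotp => //; apply: cvgB => //; exact: cvg_cst.
  have : dotp pb v + dotp wb (u - pb) <= a + b.
    apply: (cvgr_to_le cv); apply: nearW => k.
    have [c hpk /(_ _ _ hu) H] := sub k.
    by have := conjugate_ge (p k) hv; rewrite hpk lee_fin; lra.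
  lra.
have cp := conjugate_proper hp hc hl.
have [u0 /(proper_efun_fin cp)[b0 hu0]] := cp.2.
have le_conj u b : conjugate h u = b%:E ->
    (conjugate h pb <= (b - dotp wb (u - pb))%:E)%E.
  by move=> hu; apply: conjugate_le => // v a hv; exact: main.
have [a ha] : exists a : R, conjugate h pb = a%:E.
  by apply: (proper_efun_fin cp); apply: le_lt_trans (le_conj _ _ hu0) (ltry _).
exists a => // u b /le_conj; rewrite ha lee_fin; lra.
Qed.

(** [tau] need not be monotone: k <= tau k already sends it to infinity. *)
Lemma cluster_subsequence (X : pseudoMetricType R) (u : nat -> X) l :
  cluster (u @ \oo) l ->
  exists2 tau : nat -> nat, (forall k, (k <= tau k)%N) & (u \o tau) @ \oo --> l.
Proof.
move=> cl.
have ex k : exists i, (k <= i)%N /\ ball l k.+1%:R^-1 (u i).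
  have [||_ [[i ki <-] bi]] :=
    cl [set u i | i in [set i | (k <= i)%N]] (ball l k.+1%:R^-1).
  - by exists k => // i /= ki; exists i.
  - by apply: nbhsx_ballx; rewrite invr_gt0.
  - by exists i.
have [tau tauP] := choice ex.
exists tau => [k|]; first by have [] := tauP k.
apply/cvg_ballP => e e0; near=> k; apply: (@le_ball _ _ _ k.+1%:R^-1).
  by apply: ltW; near: k; exact: near_infty_natSinv_lt (PosNum e0).
by have [] := tauP k.
Unshelve. all: by end_near. Qed.

Lemma tube_center n (C : set 'cV[R]_n) c v r : C c -> enorm (v - c) <= r -> tube C r v.
Proof.
move=> Cc vr; rewrite /tube/= /setdist (le_trans _ vr)//.
apply: ge_inf; last by exists c.
by exists 0 => _ [d _ <-]; exact: enorm_ge0.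
Qed.

Lemma compact_enorm_bounded n (S : set 'cV[R]_n) : compact S ->
  exists M, forall x, S x -> enorm x <= M.
Proof.
move=> /compact_bounded[M [_ SM]].
exists (Num.sqrt n%:R * (`|M| + 1)) => x Sx.
rewrite (le_trans (enorm_le_normr _))// ler_wpM2l ?sqrtr_ge0//.
apply: SM Sx => //; rewrite (le_lt_trans (ler_norm _))//; lra.
Qed.

(** Since g(A x) is finite on [S], f(K x) = +oo would make the objective -oo there, against the
    bound; so everything reduces to real numbers. *)
Lemma objective_lower_bound n p s (S : set 'cV[R]_n) (f : 'cV[R]_p -> \bar R)
    (g : 'cV[R]_s -> \bar R) phi A K :
  proper_efun f -> S !=set0 -> (forall x, S x -> g (A *m x) \is a fin_num) ->
  (-oo < ereal_inf (objective f g phi A K @` S))%E ->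
  exists m : R, forall x, S x -> exists a b : R,
    [/\ g (A *m x) = a%:E, f (K *m x) = b%:E & m <= a + phi x - b].
Proof.
move=> fp [x0 Sx0] gfin Flb.
have fin x : S x -> exists a b : R, [/\ g (A *m x) = a%:E, f (K *m x) = b%:E &
    (ereal_inf (objective f g phi A K @` S) <= (a + phi x - b)%:E)%E].
  move=> Sx; have := ereal_inf_lbound (imageP (objective f g phi A K) Sx).
  rewrite [X in (_ <= X)%E]/objective.
  have := gfin _ Sx; case: (g _) => [a| |]// _.
  have := fp.1 (K *m x); case: (f _) => [b| |]// _ le_inf.
    by exists a, b.
  by have := lt_le_trans Flb le_inf.
have [a [b [_ _ lem]]] := fin _ Sx0.
exists (fine (ereal_inf (objective f g phi A K @` S))) => x /fin[a' [b' [-> -> le_inf]]].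
exists a', b'; split=> //; move: Flb lem le_inf; case: (ereal_inf _) => [m| |]//.
Qed.

End Limits.

Theorem theorem4p9 (R : realType) (n p s : nat)
  (S : set 'cV[R]_n) (f : 'cV[R]_p -> \bar R) (g : 'cV[R]_s -> \bar R)
  (phi : 'cV[R]_n -> R) (A : 'M[R]_(s, n)) (K : 'M[R]_(p, n)) (lphi : R)
  (* standing assumptions *)
  (S_nonempty : S !=set0) (S_convex : convex_set S) (S_compact : compact S)
  (f_proper : proper_efun f) (f_convex : convex_efun f)
  (f_lsc : lower_semicontinuous f)
  (g_proper : proper_efun g) (g_convex : convex_efun g)
  (g_lsc : lower_semicontinuous g)
  (phi_diff : forall x, differentiable phi x)
  (lphi_gt0 : 0 < lphi)
  (phi_lip : forall x u,
     enorm (gradient phi x - gradient phi u) <= lphi * enorm (x - u))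
  (sigma_gt0 : 0 < opnorm A ^+ 2)
  (* assumptions of the theorem *)
  (A_ri : mximage A S `<=` relint (edom g))
  (F_bounded : (-oo < ereal_inf (objective f g phi A K @` S))%E)
  (K_ri : mximage K S `<=` relint (edom f))
  (r : R) (r_gt0 : 0 < r)
  (Kr_int : tube (mximage A S) r `<=` interior (edom g))
  (lr : R) (lr_gt0 : 0 < lr)
  (g_lip_r : is_lipschitz_on g (tube (mximage A S) r) lr)
  (* parameters and run of the algorithm *)
  (gamma al mu eps : R)
  (gamma_gt0 : 0 < gamma) (gamma_le : gamma <= 2 * r / lr)
  (al_gt0 : 0 < al) (al_lt : al < gamma / 2) (mu_gt0 : 0 < mu)
  (eps_gt0 : 0 < eps) (eps_le : eps <= r)
  (alpha beta delta rho : nat -> R)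
  (x : nat -> 'cV[R]_n) (y : nat -> 'cV[R]_p) (z : nat -> 'cV[R]_s)
  (z0_le : enorm (z 0%N) <= lr)
  (run : adaptive_DPFS S f g phi A K lphi al gamma mu eps
           alpha beta delta rho x y z)
  (leps : R) (leps_gt0 : 0 < leps)
  (g_lip_eps : is_lipschitz_on g (tube (mximage A S) eps) leps) :
  forall (xb : 'cV[R]_n) (yb : 'cV[R]_p) (zb : 'cV[R]_s),
    cluster ((fun k => (x k, y k, z k)) @ \oo) (xb, yb, zb) ->
    approx_KKT S f g phi A K (2 * leps * eps) xb yb zb.
Proof.
move=> xb yb zb clus.

(* Inclusions satisfied by the iterates, and the bound on z *)
case: run => Px Py Pz Pal [blo [bup [blo0 Pbeta]]] Pdelta Prho.
have cf := conjugate_proper f_proper f_convex f_lsc.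
have cg := conjugate_proper g_proper g_convex g_lsc.
have ccf := conjugate_convex f_proper; have ccg := conjugate_convex g_proper.
have xS k : S (x k.+1) by have [] := Px k.
have alpha_gt k : al < alpha k.
  have [a [j [[_ P1a] _ a0 _ jS]]] := Pal; rewrite (jS k).1.
  by case: (j k) => [|i]; [rewrite a0 ltrDl|have [] := P1a i].
have alpha_gt0 k : 0 < alpha k by apply: lt_trans (alpha_gt k).
have beta_gt0 k : 0 < beta k by apply: lt_le_trans (Pbeta k).1.
(* The choice delta k = al / alpha k turns alpha k * delta k into the constant [al]. *)
have subz k : fin_subgradient (conjugate g)
    (A *m x k.+1 + al *: z k - alpha k *: z k.+1) (z k.+1).
  have := Prox_subgradient cg ccg (alpha_gt0 k) (Pz k).
  rewrite Pdelta; congr fin_subgradient.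
  by apply/colP => i; rewrite !mxE; field; rewrite gt_eqF.
have suby k : fin_subgradient (conjugate f)
    (K *m x k.+1 + beta k *: (y k - y k.+1)) (y k.+1).
  have := Prox_subgradient cf ccf (beta_gt0 k) (Py k).
  congr fin_subgradient.
  by apply/colP => i; rewrite !mxE; field; rewrite gt_eqF.
have tube_r u v : S u -> enorm (v - A *m u) <= r -> tube (mximage A S) r v.
  by move=> Su; apply: tube_center; exists u.
have g_fin v : tube (mximage A S) r v -> (g v < +oo)%E.
  by move=> /Kr_int/interior_subset.
have tubeA u : S u -> tube (mximage A S) r (A *m u).
  by move=> Su; apply: (tube_r u) => //; rewrite subrr enorm0 ltW.
(* [prox_dual_bound] on the ball of radius [r] around A x^{k+1}; its condition al * lr < r comes
   from al < gamma / 2 and gamma <= 2 r / lr. *)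
have z_le k : enorm (z k) <= lr.
  elim: k => // k ih.
  apply: (prox_dual_bound g_proper g_convex g_lsc r_gt0 lr_gt0 al_gt0
    (alpha_gt0 k) _ _ _ ih (subz k)).
  - have : gamma * lr <= 2 * r by rewrite -ler_pdivlMr.
    have : al * lr < gamma / 2 * lr by rewrite ltr_pM2r.
    by lra.
  - by move=> v vr; apply/g_fin/(tube_r (x k.+1)).
  - by move=> u v /= ur vr; apply: g_lip_r; apply: (tube_r (x k.+1)).
have ex_fin_num v : (g v < +oo)%E -> g v \is a fin_num.
  by move=> /(proper_efun_fin g_proper)[b ->].

(* Eventual constancy of the parameters *)
have [N [abar [abar_gt abar_le frozen]]] := adaptive_alpha_frozen gamma_gt0
  eps_gt0 (ltW lr_gt0) (fun k => z_le k.+1) Pal.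
pose c := abar - al; have c0 : 0 < c by rewrite subr_gt0.
pose Q := 3 * gamma / (2 * c ^+ 2).
have Q0 : 0 < Q by rewrite divr_gt0 ?mulr_gt0 ?exprn_gt0.
have c2Q : c ^+ 2 * Q = 3 / 2 * gamma by rewrite /Q; field; rewrite gt_eqF.
pose rhob := lphi / 2 + opnorm A ^+ 2 * Q + mu.
have rhoE k : (N <= k)%N -> rho k = rhob.
  move=> /frozen[ak _]; rewrite Prho ak /rhob /Q -/c; field.
  by rewrite gt_eqF.
have rhob0 : 0 < rhob by rewrite /rhob !addr_gt0// ?divr_gt0// mulr_gt0.
clearbody Q.

(* The Lyapunov function and the vanishing of the increments *)
pose F k := fine (conjugate f (y k)); pose G k := fine (conjugate g (z k)).
(* The conjugates may be infinite at the starting point, and x^0 may lie outside [S]; hence the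
   index shift in [V] and [d]. *)
have FE k : conjugate f (y k.+1) = (F k.+1)%:E by have [a E _] := suby k; rewrite /F E.
have GE k : conjugate g (z k.+1) = (G k.+1)%:E by have [a E _] := subz k; rewrite /G E.
pose V k := phi (x k.+1) + F k.+1 - dotp (K *m x k.+1) (y k.+1) +
  dotp (A *m x k.+1) (z k.+1) - G k.+1 - c / 2 * dotp (z k.+1) (z k.+1) +
  c * Q * al * dotp (z k.+1 - z k) (z k.+1 - z k).
pose d k := mu * dotp (x k.+2 - x k.+1) (x k.+2 - x k.+1) +
  beta k.+1 * dotp (y k.+2 - y k.+1) (y k.+2 - y k.+1) +
  c ^+ 2 * Q / 3 * dotp (z k.+2 - z k.+1) (z k.+2 - z k.+1).
have d_ge k : [/\ mu * enorm (x k.+2 - x k.+1) ^+ 2 <= d k,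
    blo * enorm (y k.+2 - y k.+1) ^+ 2 <= d k &
    c ^+ 2 * Q / 3 * enorm (z k.+2 - z k.+1) ^+ 2 <= d k].
  have h1 : 0 <= mu * enorm (x k.+2 - x k.+1) ^+ 2 by rewrite mulr_ge0 ?sqr_ge0 ?ltW.
  have h2 : 0 <= blo * enorm (y k.+2 - y k.+1) ^+ 2 by rewrite mulr_ge0 ?sqr_ge0 ?ltW.
  have h3 : 0 <= c ^+ 2 * Q / 3 * enorm (z k.+2 - z k.+1) ^+ 2.
    by rewrite mulr_ge0 ?sqr_ge0// c2Q; lra.
  have h4 : blo * enorm (y k.+2 - y k.+1) ^+ 2 <= beta k.+1 * enorm (y k.+2 - y k.+1) ^+ 2.
    by rewrite ler_wpM2r ?sqr_ge0// (Pbeta _).1.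
  by rewrite /d -!enorm_sqr; split; lra.
have d_ge0 k : 0 <= d k.
  by have [+ _ _] := d_ge k; apply: le_trans; rewrite mulr_ge0 ?sqr_ge0 ?ltW.
have Vd k : (N <= k)%N -> V k.+1 + d k <= V k.
  move=> Nk; have Nk1 := leqW Nk.
  have [a Ha subk] := subz k; have [a' Ha' subk'] := subz k.+1.
  move: Ha Ha' subk subk'; rewrite !GE => -[<-] -[<-] subk subk'.
  have [b Hb subf] := suby k.+1; move: Hb subf; rewrite FE => -[<-] subf.
  rewrite (frozen _ Nk).1 in subk; rewrite (frozen _ Nk1).1 in subk'.
  have := Proj_variational S_convex (Px k.+1) (xS k); rewrite (rhoE _ Nk1).
  set gr := gradient phi (x k.+1) => Hx.
  pose dx := x k.+2 - x k.+1; pose dz := z k.+2 - z k.+1.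
  pose e := z k.+1 - z k; pose h := y k.+2 - y k.+1.
  have xE : x k.+2 = x k.+1 + dx by rewrite /dx addrC subrK.
  have zE : z k.+2 = z k.+1 + dz by rewrite /dz addrC subrK.
  have yE : y k.+2 = y k.+1 + h by rewrite /h addrC subrK.
  have eE : z k = z k.+1 - e by rewrite /e opprB addrC subrK.
  rewrite /V /d -/dx -/dz -/e -/h.
  have := @lyapunov_step _ _ _ (z k.+1) dz e (A *m x k.+1) (A *m dx) (y k.+1) h
    (K *m x k.+1) (K *m dx) (phi (x k.+1)) (phi (x k.+2)) (F k.+1) (F k.+2)
    (G k.+1) (G k.+2) (dotp gr dx) (dotp dx dx) (opnorm A ^+ 2) lphi al c Q
    (beta k.+1) mu rhob c0 Q0 (ltW al_gt0).
  rewrite -!mulmxDr -xE -zE -yE; apply=> //.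
  (* As c^2 Q = 3/2 gamma, this condition and the next read c <= gamma and al <= gamma / 2. *)
  - by rewrite -mulrA c2Q; rewrite /c; lra.
  - by rewrite c2Q; lra.
  - by have := descent_lemma (x k.+1) (x k.+2) phi_diff phi_lip; rewrite enorm_sqr.
  - move: Hx; rewrite -[x k.+1 - x k.+2]opprB -/dx.
    rewrite (_ : x k.+1 + _ - x k.+2 =
      rhob^-1 *: (- gr + K^T *m y k.+1 - A^T *m z k.+1) - dx); last first.
      by rewrite xE; apply/colP => i; rewrite !mxE; lra.
    rewrite dotpNr oppr_le0 dotpDl dotpNl dotpZl !dotpDl !dotpNl subr_ge0.
    rewrite ler_pdivlMl// (dotpC (K^T *m _)) -dotp_mulmx (dotpC (A^T *m _)) -dotp_mulmx.
    by rewrite (dotpC (y _)) (dotpC (z _)).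
  - have := subf _ _ (FE k); rewrite -[y k.+1 - y k.+2]opprB -/h.
    by rewrite scalerN.
  - rewrite -!enorm_sqr -exprMn ler_sqr ?nnegrE ?enorm_ge0 ?opnorm_ub//.
    by rewrite (le_trans (enorm_ge0 _) (opnorm_ub _ _)).
  - have := subk _ _ (GE k.+1); rewrite -/dz -eE (_ : c + al = abar)//.
    by rewrite /c subrK.
  - have := subk' _ _ (GE k); rewrite -[z k.+1 - z k.+2]opprB -/dz.
    by rewrite (_ : c + al = abar)// /c subrK.
have [M SM] := compact_enorm_bounded S_compact.
have AM u : S u -> enorm (A *m u) <= opnorm A * M.
  by move=> Su; rewrite (le_trans (opnorm_ub _ _))// ler_wpM2l ?SM// opnorm_ge0.
have [mV V_ge] : exists m, forall k, (N <= k)%N -> m <= V k.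
  have [m Hm] := objective_lower_bound f_proper S_nonempty (fun u Su =>
    ex_fin_num _ (g_fin _ (tubeA _ Su))) F_bounded.
  have [u0 /(proper_efun_fin cg)[cu gu0]] := cg.2.
  have [x0 Sx0] := S_nonempty; have [g0 [_ [gx0 _ _]]] := Hm _ Sx0.
  pose B := opnorm A * M.
  (* Term by term: Fenchel-Young gives phi + F - <K x, y> >= phi - f(K x) >= m - g(A x), with [g]
     bounded on A(S) by its Lipschitz constant; then <A x, z>; then g^*(z), bounded above by the
     subgradient inequality tested at a point [u0] of its domain; then c/2 |z|^2. *)
  exists (m - (g0 + lr * (B + B)) - B * lr -
    (cu + (B + al * lr + abar * lr) * (enorm u0 + lr)) - c / 2 * lr ^+ 2) => k Nk.
  have [a [b [ga fb mab]]] := Hm _ (xS k).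
  have := conjugate_ge (y k.+1) fb; rewrite FE lee_fin dotpC => Fb.
  have := g_lip_r _ _ (tubeA _ (xS k)) (tubeA _ Sx0).
  rewrite ga gx0 -EFinB abse_EFin lee_fin => /ler_normlW gb.
  have AB : enorm (A *m x k.+1 - A *m x0) <= B + B.
    by rewrite (le_trans (enormD _ _))// enormN lerD// AM.
  have gB : lr * enorm (A *m x k.+1 - A *m x0) <= lr * (B + B) by rewrite ler_pM2l.
  have [G' + /(_ _ _ gu0)] := subz k; rewrite GE (frozen _ Nk).1 => -[<-] Gb.
  have abar0 : 0 < abar by exact: lt_trans abar_gt.
  have qB : enorm (A *m x k.+1 + al *: z k - abar *: z k.+1) <= B + al * lr + abar * lr.
    rewrite (le_trans (enormD _ _))// enormN lerD//; last first.
      by rewrite enormZ gtr0_norm// ler_pM2l.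
    rewrite (le_trans (enormD _ _))// lerD ?AM//.
    by rewrite enormZ gtr0_norm// ler_pM2l.
  have uz : enorm (u0 - z k.+1) <= enorm u0 + lr.
    by rewrite (le_trans (enormD _ _))// enormN lerD2l.
  have := normr_dotp (A *m x k.+1 + al *: z k - abar *: z k.+1) (u0 - z k.+1).
  rewrite ler_norml => /andP[+ _].
  have := ler_pM (enorm_ge0 _) (enorm_ge0 _) qB uz.
  have := normr_dotp (A *m x k.+1) (z k.+1); rewrite ler_norml => /andP[+ _].
  have := ler_pM (enorm_ge0 _) (enorm_ge0 _) (AM _ (xS k)) (z_le k.+1); rewrite -/B.
  have zz : dotp (z k.+1) (z k.+1) <= lr ^+ 2 by rewrite -enorm_leP// ltW.
  have : c / 2 * dotp (z k.+1) (z k.+1) <= c / 2 * lr ^+ 2 by rewrite ler_pM2l ?divr_gt0.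
  have : 0 <= c * Q * al * dotp (z k.+1 - z k) (z k.+1 - z k).
    by rewrite !mulr_ge0 ?dotp_ge0 ?(ltW c0) ?(ltW Q0) ?(ltW al_gt0).
  rewrite /V.
  move: Gb; move: (A *m _ + _ - _) (u0 - _) => w v; lra.
have d_cvg : d @ \oo --> (0 : R).
  exact: (@decrement_cvg0 _ V d N mV).
have cvg_incr m q (u : nat -> 'cV[R]_m) : 0 < q ->
    (forall k, q * enorm (u k) ^+ 2 <= d k) -> u @ \oo --> (0 : 'cV[R]_m).
  move=> q0 ud; apply: enorm_sqr_cvg.
  apply: (@squeeze_cvgr _ _ _ _ (fun=> 0) (fun k => q^-1 * d k)).
  - by apply: nearW => k; rewrite sqr_ge0 ler_pdivlMl// ud.
  - exact: cvg_cst.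
  - by rewrite -[X in _ --> X](mulr0 q^-1); apply: cvgM => //; exact: cvg_cst.
have dx0 : (fun k => x k.+2 - x k.+1) @ \oo --> (0 : 'cV[R]_n).
  by apply: (cvg_incr _ _ _ mu_gt0) => k; have [] := d_ge k.
have dy0 : (fun k => y k.+2 - y k.+1) @ \oo --> (0 : 'cV[R]_p).
  by apply: (cvg_incr _ _ _ blo0) => k; have [] := d_ge k.
have dz0 : (fun k => z k.+2 - z k.+1) @ \oo --> (0 : 'cV[R]_s).
  apply: (cvg_incr _ (c ^+ 2 * Q / 3)) => [|k]; last by have [] := d_ge k.
  by rewrite c2Q; lra.

(* Limits along a convergent subsequence *)
have [tau tau_ge tau_cvg] := cluster_subsequence clus.
pose m i := (tau (i + N.+2) - 2)%N.
have mE i : tau (i + N.+2)%N = (m i).+2.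
  rewrite /m; case: (tau _) (tau_ge (i + N.+2)%N) => [|[|t]]; rewrite ?addnS//.
  by move=> _; rewrite subn2.
have m_ge i : (i + N <= m i)%N by rewrite -2!ltnS -mE -!addnS.
have Nm i : (N <= m i)%N by rewrite (leq_trans _ (m_ge i))// leq_addl.
have m_oo : m @ \oo --> \oo.
  apply/cvgnyPge => a; exists a => // i /= ai.
  by rewrite (leq_trans ai)// (leq_trans _ (m_ge i))// leq_addr.
have cvg2 : (fun i => (x (m i).+2, y (m i).+2, z (m i).+2)) @ \oo --> (xb, yb, zb).
  have sh : (fun i => i + N.+2)%N @ \oo --> \oo.
    by apply/cvgnyPge => a; exists a => // i /= ai; rewrite (leq_trans ai)// leq_addr.
  have := cvg_comp _ _ sh tau_cvg.
  rewrite (_ : _ \o _ = (fun i => (x (m i).+2, y (m i).+2, z (m i).+2)))//.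
  by apply/funext => i /=; rewrite mE.
have x2 : (fun i => x (m i).+2) @ \oo --> xb.
  exact: (cvg_comp _ _ (cvg_comp _ _ cvg2 cvg_fst) cvg_fst).
have y2 : (fun i => y (m i).+2) @ \oo --> yb.
  exact: (cvg_comp _ _ (cvg_comp _ _ cvg2 cvg_fst) cvg_snd).
have z2 : (fun i => z (m i).+2) @ \oo --> zb.
  exact: (cvg_comp _ _ cvg2 cvg_snd).
(* As the increments vanish, the preceding iterates have the same limit. *)
have prev q (u : nat -> 'cV[R]_q) (l : 'cV[R]_q) :
    (fun k => u k.+2 - u k.+1) @ \oo --> (0 : 'cV[R]_q) ->
    (fun i => u (m i).+2) @ \oo --> l -> (fun i => u (m i).+1) @ \oo --> l.
  move=> du u2; rewrite -(subr0 l).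
  rewrite (_ : (fun i => _) = (fun i => u (m i).+2 - (u (m i).+2 - u (m i).+1))); last first.
    by apply/funext => i; rewrite opprB addrC subrK.
  by apply: cvgB => //; exact: (cvg_comp _ _ m_oo du).
have x1 := prev _ _ _ dx0 x2; have y1 := prev _ _ _ dy0 y2.
have z1 := prev _ _ _ dz0 z2.
have Sxb : S xb.
  have S_closed : closed S by apply: compact_closed => //; exact: norm_hausdorff.
  by apply: (closed_cvg S S_closed _ xb x2); apply: nearW => i; exact: xS.
have zb_eps : c * enorm zb <= eps.
  have H : (fun i => c * enorm (z (m i).+2)) @ \oo --> c * enorm zb.
    by apply: cvgM; [exact: cvg_cst|exact: cvg_enorm].
  by apply: (cvgr_to_le H); apply: nearW => i; exact: (frozen _ (leqW (Nm i))).2.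
(* In the limit the terms in [al] of consecutive iterates combine, leaving abar - al = c. *)
have subzb : fin_subgradient (conjugate g) (A *m xb - c *: zb) zb.
  have -> : A *m xb - c *: zb = A *m xb + al *: zb - abar *: zb.
    by apply/colP => i; rewrite /c !mxE; ring.
  apply: (conjugate_subgradient_cvg g_proper g_convex g_lsc _ z2 (fun i => subz (m i).+1)).
  rewrite (_ : (fun i => _) =
    (fun i => A *m x (m i).+2 + al *: z (m i).+1 - abar *: z (m i).+2)); last first.
    by apply/funext => i; rewrite (frozen _ (leqW (Nm i))).1.
  apply: cvgB; last by apply: cvgZ => //; exact: cvg_cst.
  apply: cvgD; first exact: cvg_mulmx.
  by apply: cvgZ => //; exact: cvg_cst.
have subyb : fin_subgradient (conjugate f) (K *m xb) yb.
  apply: (conjugate_subgradient_cvg f_proper f_convex f_lsc _ y2 (fun i => suby (m i).+1)).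
  rewrite -[X in _ --> X]addr0; apply: cvgD; first exact: cvg_mulmx.
  apply: enorm_cvg.
  apply: (@squeeze_cvgr _ _ _ _ (fun=> 0) (fun i => bup * enorm (y (m i).+2 - y (m i).+1))).
  - apply: nearW => i; rewrite enorm_ge0/= subr0 enormZ gtr0_norm// enormB.
    by rewrite ler_wpM2r ?enorm_ge0// (Pbeta _).2.
  - exact: cvg_cst.
  - rewrite -[X in _ --> X](mulr0 bup); apply: cvgM; first exact: cvg_cst.
    by rewrite -(enorm0 p); apply: cvg_enorm; exact: (cvg_comp _ _ m_oo dy0).
have grad_cvg : (fun i => gradient phi (x (m i).+1)) @ \oo --> gradient phi xb.
  apply: enorm_cvg.
  apply: (@squeeze_cvgr _ _ _ _ (fun=> 0) (fun i => lphi * enorm (x (m i).+1 - xb))).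
  - by apply: nearW => i; rewrite enorm_ge0 phi_lip.
  - exact: cvg_cst.
  - rewrite -[X in _ --> X](mulr0 lphi); apply: cvgM; first exact: cvg_cst.
    rewrite -(enorm0 n) -(subrr xb); apply: cvg_enorm.
    by apply: cvgB => //; exact: cvg_cst.

(* The three KKT conditions at the limit *)
split.
- have [b gzb subb] := subzb; split; first by rewrite gzb.
  pose w := A *m xb - c *: zb.
  have tube_eps v : enorm (v - A *m xb) <= eps -> tube (mximage A S) eps v.
    by apply: tube_center; exists xb.
  have wA : enorm (w - A *m xb) <= eps.
    by rewrite /w addrAC subrr add0r enormN enormZ gtr0_norm.
  have [gw gwE] : exists gw : R, g w = gw%:E.
    apply: (proper_efun_fin g_proper); apply/g_fin/(tube_r xb) => //.
    exact: le_trans eps_le.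
  have [gA gAE] : exists gA : R, g (A *m xb) = gA%:E.
    by apply: (proper_efun_fin g_proper); apply/g_fin/tubeA.
  (* Thus g(w) + g^*(zb) <= <zb, A xb> - c |zb|^2. Replacing g(w) by g(A xb) costs at most leps *
     eps, and Fenchel-Young at A xb bounds g^*(u) below. *)
  have := fenchel_equality g_proper g_convex g_lsc gwE gzb subzb.
  rewrite {1}/w dotpDr dotpNr dotpZr => fenchel.
  have zz : 0 <= c * dotp zb zb by rewrite mulr_ge0 ?dotp_ge0 ?(ltW c0).
  have tubeAxb : tube (mximage A S) eps (A *m xb).
    by apply: tube_eps; rewrite subrr enorm0 ltW.
  have := g_lip_eps _ _ tubeAxb (tube_eps _ wA).
  rewrite gAE gwE -EFinB abse_EFin lee_fin enormB => /ler_normlW lipw.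
  have lw : leps * enorm (w - A *m xb) <= leps * eps by rewrite ler_pM2l.
  have le0 : 0 < leps * eps by rewrite mulr_gt0.
  move=> u; have := conjugate_ge u gAE; rewrite gzb.
  have := cg.1 u; case: (conjugate g u) => [k| |]// _; last by move=> _; rewrite leey.
  rewrite -EFinD !lee_fin dotpDr dotpNr.
  rewrite (dotpC (A *m xb) u) (dotpC (A *m xb) zb); lra.
- have [b fyb subb] := subyb; split; first by rewrite fyb.
  move=> u; rewrite fyb sube0.
  have := cf.1 u; case E : (conjugate f u) => [k| |]// _; last by rewrite leey.
  by rewrite -EFinD lee_fin; exact: subb.
- exists (- gradient phi xb + K^T *m yb - A^T *m zb); last first.
    by move: (gradient phi xb) => gr; apply/colP => i; rewrite !mxE; ring.
  split=> // u Su.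
  set v := _ - _;
  pose vi i := - gradient phi (x (m i).+1) + K^T *m y (m i).+1 - A^T *m z (m i).+1.
  have v_cvg : vi @ \oo --> v.
    apply: cvgB; last exact: cvg_mulmx.
    by apply: cvgD; [exact: cvgN|exact: cvg_mulmx].
  (* Consecutive x cancel in the limit, so the projection inequality tends to the normal cone
     inequality scaled by 1 / rhob. *)
  have w_cvg : (fun i => x (m i).+1 + rhob^-1 *: vi i - x (m i).+2) @ \oo --> rhob^-1 *: v.
    rewrite -[X in _ --> X](addrK xb) (addrC _ xb).
    apply: cvgB => //; apply: cvgD => //.
    by apply: cvgZ => //; exact: cvg_cst.
  have lim : (fun i =>
      dotp (x (m i).+1 + rhob^-1 *: vi i - x (m i).+2) (u - x (m i).+2)) @ \oo -->
      dotp (rhob^-1 *: v) (u - xb).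
    by apply: cvg_dotp => //; apply: cvgB => //; exact: cvg_cst.
  have : dotp (rhob^-1 *: v) (u - xb) <= 0.
    apply: (cvgr_to_le lim); apply: nearW => i.
    have := Proj_variational S_convex (Px (m i).+1) Su.
    by rewrite (rhoE _ (leqW (Nm i))) div1r.
  by rewrite dotpZl pmulr_rle0 ?invr_gt0.
Qed.
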